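(* Let $P$ be a simple $d$-polytope, $d\ge1$. Then the following properties are equivalent. (1) The polytope $P$ is even. (2) The vertex-edge-graph of $P$ is bipartite. (3) The boundary complex $\partial P^*$ of the dual polytope $P^*$ is balanced. (4) $\gamma(P)=d$.
   Context: Polytopes are convex. A $d$-polytope is simple if each of its vertex figures is a simplex; equivalently each vertex lies in exactly $d$ facets; equivalently the dual polytope $P^*$ is simplicial, so that $\partial P^*$ is a $(d-1)$-dimensional simplicial complex. A simple polytope is even if each of its $2$-faces has an even number of vertices (a $2$-polytope is regarded as a $2$-face of itself). The vertex-edge-graph of $P$ is its $1$-skeleton. A $k$-dimensional simplicial complex is balanced if there is a map $c$ from its vertices to $\{0,\ldots,k\}$ such that $c(x)\neq c(y)$ whenever $\{x,y\}$ is an edge of the complex. The chromatic number $\gamma(P)$ is the chromatic number of the graph $\overline{\Gamma}(P)$ whose nodes are the facets of $P$ and in which two (distinct) facets are joined by an edge iff their intersection is non-empty; i.e. $\gamma(P)$ is the minimal number of colors needed to color the facets of $P$ such that any two distinct facets with non-empty intersection have different colors. *)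

(* Defs.v *)
From mathcomp Require Import all_boot all_order all_algebra.
From mathcomp Require Import all_classical all_reals all_analysis.

Set Implicit Arguments.
Unset Strict Implicit.
Unset Printing Implicit Defensive.

Import Order.TTheory GRing.Theory Num.Theory.
Import numFieldNormedType.Exports.

Local Open Scope classical_set_scope.
Local Open Scope ring_scope.
Local Open Scope card_scope.

Section Polytopes.
Context {R : realType} {n : nat}.
Implicit Types (A P Q F : set 'rV[R]_n) (x y z a : 'rV[R]_n).
Implicit Types (C : set (set 'rV[R]_n)).

Definition dot x y : R := (x *m y^T) 0 0.

Definition convex_hull (m : nat) (v : 'I_m -> 'rV[R]_n) : set 'rV[R]_n :=
  [set x | exists w : 'I_m -> R,
    [/\ forall i, 0 <= w i, \sum_i w i = 1 & x = \sum_i w i *: v i]].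

Definition polytope P :=
  exists (m : nat) (v : 'I_m -> 'rV[R]_n), P = convex_hull v.

Definition affine_hull A : set 'rV[R]_n :=
  [set x | exists (m : nat) (v : 'I_m -> 'rV[R]_n) (w : 'I_m -> R),
    [/\ forall i, A (v i), \sum_i w i = 1 & x = \sum_i w i *: v i]].

(* A relation rather than a function, so that set0, whose dimension is -1 by
   the usual convention, satisfies [has_dim set0 k] for no [k : nat]. *)
Definition has_dim A (k : nat) :=
  exists x (U : {vspace 'rV[R]_n}),
    affine_hull A = [set y | y - x \in U] /\ \dim U = k.

(* [a = 0] gives the two improper faces, P itself ([b = 0]) and set0. *)
Definition face P : set (set 'rV[R]_n) :=
  [set F | exists a (b : R),
    (forall x, P x -> dot a x <= b) /\ F = P `&` [set x | dot a x = b]].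

Definition facet P : set (set 'rV[R]_n) :=
  [set F | face P F /\ exists k, has_dim P k.+1 /\ has_dim F k].

(* Below, a polytopal complex is given by the set of its cells. *)

Definition vertex C : set 'rV[R]_n := [set x | C [set x]].

Definition joined_by_edge C x y :=
  x <> y /\ exists e, [/\ C e, has_dim e 1, e x & e y].

Definition complex_dim C (k : nat) :=
  (exists F, C F /\ has_dim F k) /\
  (forall F j, C F -> has_dim F j -> (j <= k)%N).

Definition balanced C :=
  exists k : nat, complex_dim C k /\
  exists c : 'rV[R]_n -> 'I_k.+1,
    forall x y, vertex C x -> vertex C y -> joined_by_edge C x y -> c x <> c y.

Definition boundary_complex P : set (set 'rV[R]_n) :=
  [set F | face P F /\ F <> P].

Definition affinely_independent (m : nat) (v : 'I_m -> 'rV[R]_n) :=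
  forall w : 'I_m -> R,
    \sum_i w i = 0 -> \sum_i w i *: v i = 0 -> forall i, w i = 0.

Definition simplex Q :=
  exists (m : nat) (v : 'I_m -> 'rV[R]_n),
    affinely_independent v /\ Q = convex_hull v.

(* The sections of P by hyperplanes that strictly separate the vertex x from
   all the other vertices. *)
Definition vertex_figure P x : set (set 'rV[R]_n) :=
  [set Q | exists a (b : R),
    [/\ b < dot a x,
        forall y, vertex (face P) y -> y <> x -> dot a y < b
      & Q = P `&` [set y | dot a y = b]]].

Definition simple_polytope P :=
  polytope P /\
  forall x, vertex (face P) x -> forall Q, vertex_figure P x Q -> simplex Q.

Definition even_polytope P :=
  forall F, face P F -> has_dim F 2 ->
    exists m : nat, vertex (face F) #= `I_(m.*2).

Definition relative_interior P : set 'rV[R]_n :=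
  [set z | P z /\ \forall y \near z, affine_hull P y -> P y].

(* The polar of [P - z] inside the linear space parallel to the affine hull
   of P; for z in the relative interior of P it is a polytope, of the same
   dimension as P. *)
Definition dual_polytope P z : set 'rV[R]_n :=
  [set y | affine_hull P (z + y) /\ forall x, P x -> dot (x - z) y <= 1].

End Polytopes.

Section Graphs.
Context {T : Type}.
Implicit Types (V : set T) (E : T -> T -> Prop).

Definition bipartite V E :=
  exists c : T -> bool, forall x y, V x -> V y -> E x y -> c x <> c y.

Definition colorable V E (k : nat) :=
  exists c : T -> nat, (forall x, V x -> (c x < k)%N) /\
    forall x y, V x -> V y -> E x y -> c x <> c y.

(* 0 if no finite number of colors suffices. *)
Definition chromatic_number V E : nat :=
  xget 0%N [set k | colorable V E k /\ forall j, colorable V E j -> (k <= j)%N].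

End Graphs.

Definition gamma (R : realType) (n : nat) (P : set 'rV[R]_n) : nat :=
  chromatic_number (facet P) (fun F G => F <> G /\ F `&` G !=set0).

(* The base points z needed to form [dual_polytope P z] exist. *)
Lemma relative_interior_nonempty (R : realType) (n d : nat) (P : set 'rV[R]_n) :
  polytope P -> has_dim P d -> relative_interior P !=set0.
Proof.
move=> [m [v ->]] [x0 [U [hullE _]]].
have m_gt0 : (0 < m)%N.
  have: affine_hull (convex_hull v) x0 by rewrite hullE /= subrr mem0v.
  move=> [k [p [w [vp w1 _]]]]; case: k p w vp w1 => [|k] p w vp w1.
    by move: w1; rewrite big_ord0 => /eqP; rewrite eq_sym oner_eq0.
  have [c [_ c1 _]] := vp ord0; case: m v c c1 {vp hullE p} => // v c.
  by rewrite big_ord0 => /eqP; rewrite eq_sym oner_eq0.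
pose u : R := m%:R^-1.
have u_gt0 : 0 < u by rewrite invr_gt0 ltr0n.
have mu : u *+ m = 1 by rewrite -mulr_natr mulVf // pnatr_eq0 -lt0n.
pose z : 'rV[R]_n := \sum_i u *: v i.
have su1 : \sum_(i < m) u = 1 by rewrite sumr_const card_ord mu.
exists z; split; first by exists (fun=> u); split => // i; exact: ltW.
pose B := \matrix_i (v i - z).
pose K := pinvmx B *m (1%:M - const_mx u) : 'M[R]_(n, m).
pose w (y : 'rV[R]_n) i := u + ((y - z) *m K) 0 i.
have zE : \sum_i u *: v i = z by [].
have rowB (r : 'rV[R]_m) : r *m B = \sum_i r 0 i *: v i - (\sum_i r 0 i) *: z.
  rewrite mulmx_sum_row scaler_suml -sumrB; apply: eq_bigr => i _.
  by rewrite rowK scalerBr.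
have wE y : (y - z <= B)%MS -> \sum_i w y i = 1 /\ y = \sum_i w y i *: v i.
  move=> yB; pose r := (y - z) *m pinvmx B.
  have wi i : w y i = u + (r 0 i - (\sum_j r 0 j) * u).
    rewrite /w /K mulmxA mulmxBr mulmx1 !mxE; congr (_ + (_ - _)).
    by rewrite mulr_suml; apply: eq_bigr => j _; rewrite [const_mx _ _ _]mxE.
  have wif : w y =1 fun i => u + (r 0 i - (\sum_j r 0 j) * u) by [].
  split.
    rewrite (eq_bigr _ (fun i _ => wi i)) big_split sumrB /= su1.
    by rewrite -mulr_sumr su1 mulr1 subrr addr0.
  rewrite (eq_bigr (fun i => u *: v i + (r 0 i *: v i - (\sum_j r 0 j) *: (u *: v i)))).
    rewrite big_split sumrB /= zE -scaler_sumr zE -rowB mulmxKpV //.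
    by rewrite addrC subrK.
  by move=> i _; rewrite wi scalerDl scalerBl scalerA.
have affB y : affine_hull (convex_hull v) y -> (y - z <= B)%MS.
  have vB i : (v i - z <= B)%MS by rewrite -[v i - z](rowK (fun i => v i - z)) row_sub.
  have cB x : convex_hull v x -> (x - z <= B)%MS.
    move=> [c [_ c1 ->]]; rewrite -[z]scale1r -c1 scaler_suml -sumrB.
    by apply: summx_sub => i _; rewrite -scalerBr scalemx_sub.
  move=> [k [p [c [vp c1 ->]]]]; rewrite -[z]scale1r -c1 scaler_suml -sumrB.
  by apply: summx_sub => i _; rewrite -scalerBr scalemx_sub ?cB.
have w_near i : \forall y \near z, 0 < w y i.
  have: (fun y => w y i) @ z --> u + \sum_j (z 0 j - z 0 j) * K j i.
    have -> : (fun y => w y i) = fun y => u + \sum_j (y 0 j - z 0 j) * K j i.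
      by apply/funext => y; rewrite /w mxE; congr (_ + _); apply: eq_bigr => j _;
         rewrite !mxE.
    apply: (cvgD (FF := nbhs_filter z) (cvg_cst _)).
    apply: (@cvg_big R _ _ _ _ add_continuous) => j _.
    apply: (cvgM _ (cvg_cst _)); apply: (cvgB _ (cvg_cst _)).
    exact: coord_continuous.
  rewrite big1 ?addr0 => [/cvgr_gt/(_ _ u_gt0)//|j _].
  by rewrite subrr mul0r.
have : \forall y \near z, forall i, 0 < w y i by apply: (@filter_forall _ _ (fun i y => 0 < w y i) _ (nbhs_filter z)).
apply: filterS => y w_gt0 /affB /wE[w1 yE].
by exists (w y); split => // i; exact: ltW.
Qed.

(* Main.v *)
Require Import Defs.
From mathcomp Require Import all_boot all_order all_algebra.
From mathcomp Require Import ring lra.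
From mathcomp Require Import all_classical all_reals all_analysis.

Set Implicit Arguments.
Unset Strict Implicit.
Unset Printing Implicit Defensive.

Import Order.TTheory GRing.Theory Num.Theory.
Import numFieldNormedType.Exports.

(** Everything local about a simple polytope P follows from one fact
    ([vertex_corner]): at a vertex x, the simplex that serves as vertex figure
    provides d linearly independent vectors e_k such that P lies in the cone
    x + sum_k R_+ e_k and contains the points x + e_k.  The faces through x then
    correspond to the sets of edges at x.  In particular x lies on d facets,
    leaving one of them leads along an edge to exactly one other vertex, and any
    two edges at x span a 2-face.  This makes the vertices and facets of P a
    finite incidence structure ([facet_incidence]); convexity enters its study
    only through linear functionals, for which a vertex that is lowest among its
    neighbors in a face is lowest in that face ([linear_local_min]).

    Choose a linear functional that separates the vertices
    ([generic_functional]) and add the vertices from the lowest to the highest.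
    A new vertex v with two lower neighbors is the highest vertex of the 2-face
    spanned by the two edges, so the other vertices of that 2-face have all been
    treated already; their number is odd if P is even.
    - To color the vertices with two colors, the lower neighbors of v must agree.
      If two of them had different colors, counting the edges of their 2-face
      between the color classes would show that the two classes, taken without v,
      have the same size, whereas their sizes add up to an odd number
      ([even_bipartite]).
    - To color the facets with d colors, so that the facets at each vertex have
      different colors, the critical case is that of a vertex v with exactly two
      lower neighbors, where no earlier vertex separates the colors of two facets
      F and G at v.  If these were equal, then among the two colors that remain
      for the 2-face one would be missing at v, and the edges of the 2-face that
      lie on facets of that color would match its other vertices in pairs
      ([even_colored]).
    The same counts over all vertices of a 2-face show that P is even if its graph
    is bipartite ([bipartite_even]) or its facets are d-colorable
    ([colored_even]).  Since d facets meet at a vertex, d colors are also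
    necessary, so the latter condition says that gamma P = d ([gammaP]).

    For the dual polytope, a bipolar argument by separation
    ([dual_boundary_point]) shows that every nonempty proper face of it lies in
    the hyperplane dual to some point of P.  Therefore the vertices y of the dual
    polytope correspond to the facets on which <p - z, y> = 1, and two of them
    are joined by an edge exactly when the facets meet ([joined_dual_facets]).
    As the boundary of the dual has dimension d - 1, it is balanced iff the
    facets of P can be colored with d colors ([balanced_dualP]). *)

(** * Parity arguments on the vertices and facets of a simple polytope *)

Section Incidence.
Import boot.fintype boot.finset.
Context {V : finType} (FS : {set {set V}}).
Implicit Types (u v w : V) (F G H : {set V}) (B : {set {set V}}) (S D : {set V}).

Definition facets_at v := [set F in FS | v \in F].

(** The vertices of the face in which the facets of B intersect *)
Definition common B := [set v | B \subset facets_at v].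

Definition adjacent v w :=
  (v != w) && [exists F in facets_at v, w \in common (facets_at v :\ F)].

(** The incidences of a simple d-polytope: the intersection of all facets at v but
    one is an edge at v, whose other endpoint lies outside the omitted facet. *)
Definition simple_incidence d :=
  (forall v, #|facets_at v| = d) /\
  (forall v F, F \in facets_at v ->
     exists w, w \notin F /\ common (facets_at v :\ F) = [set v; w]).

(** The facets at v other than F and G intersect in a 2-face, and all 2-faces at v
    are of this form. *)
Definition even_2faces :=
  forall v F G, F \in facets_at v -> G \in facets_at v -> F != G ->
    ~~ odd #|common (facets_at v :\ F :\ G)|.

Definition bipartite_on D (col : V -> bool) :=
  {in D &, forall v w, adjacent v w -> col v != col w}.

Definition colored_on d D (c : {set V} -> nat) :=
  {in D, forall v, {in facets_at v, forall F, c F < d} /\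
                   {in facets_at v &, injective c}}.

(** The property of linear functionals on faces by which convexity is used *)
Definition local_min_global (R : realDomainType) (f : V -> R) :=
  forall v B, B \subset facets_at v ->
    (forall w, adjacent v w -> w \in common B -> (f v <= f w)%R) ->
  forall w, w \in common B -> (f v <= f w)%R.

(** The other endpoint of the edge at v that is not contained in F; the default
    value v is taken only if F is not a facet at v. *)
Definition opposite v F := odflt v [pick w in common (facets_at v :\ F) | w \notin F].

Lemma mem_facets_at v F : (F \in facets_at v) = (F \in FS) && (v \in F).
Proof. by rewrite inE. Qed.

Lemma mem_common v B : (v \in common B) = (B \subset facets_at v).
Proof. by rewrite inE. Qed.

Section Simple.
Context (d : nat) (incP : simple_incidence d).

Lemma card_facets_at v : #|facets_at v| = d.
Proof. by case: incP. Qed.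

Lemma oppositeP v F : F \in facets_at v ->
  opposite v F \notin F /\ common (facets_at v :\ F) = [set v; opposite v F].
Proof.
move=> Fv; have [w [wF wE]] := incP.2 _ _ Fv.
have vF : v \in F by move: Fv; rewrite mem_facets_at => /andP[].
rewrite /opposite; case: pickP => [x /andP[]|/(_ w)]; rewrite wE !inE ?eqxx ?orbT ?wF //.
by case/orP => /eqP->; rewrite ?vF.
Qed.

Lemma adjacentP v w :
  reflect (exists2 F, F \in facets_at v & w = opposite v F) (adjacent v w).
Proof.
apply: (iffP andP) => [[vw /existsP[F /andP[Fv]]]|[F Fv ->]].
  have [_ ->] := oppositeP Fv; rewrite !inE eq_sym (negPf vw) /= => /eqP->.
  by exists F.
have [nF cF] := oppositeP Fv; split.
  by apply: contraNneq nF => <-; move: Fv; rewrite mem_facets_at => /andP[].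
by apply/existsP; exists F; rewrite Fv cF !inE eqxx orbT.
Qed.

(** Both endpoints of an edge lie on d facets, d - 1 of which contain the edge. *)
Lemma opposite_exchange v F : F \in facets_at v ->
  exists F', [/\ F' \in facets_at (opposite v F), F' \notin facets_at v &
                 facets_at (opposite v F) :\ F' = facets_at v :\ F].
Proof.
move=> Fv; have [nF cF] := oppositeP Fv; set w := opposite v F in nF cF *.
have sub : facets_at v :\ F \subset facets_at w.
  by rewrite -mem_common cF !inE eqxx orbT.
have /cards1P[F' eF'] : #|facets_at w :\: (facets_at v :\ F)| == 1.
  by rewrite cardsD (setIidPr sub) card_facets_at -(card_facets_at v) (cardsD1 F) Fv addnK.
have : F' \in facets_at w :\: (facets_at v :\ F) by rewrite eF' set11.
rewrite in_setD => /andP[nF' F'w]; exists F'; split => //.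
  apply: contraNN nF' => F'v; rewrite in_setD1 F'v andbT.
  by apply: contraNneq nF => <-; move: F'w; rewrite mem_facets_at => /andP[].
by rewrite -eF' setDDr setDv set0U (setIidPr sub).
Qed.

Lemma adjacent_sym : symmetric adjacent.
Proof.
suff sym v w : adjacent v w -> adjacent w v by move=> v w; apply/idP/idP => /sym.
move=> vw; case/andP: (vw) => nvw _; case/adjacentP: vw => F Fv wE.
rewrite wE in nvw *; have [F' [F'w F'v eF']] := opposite_exchange Fv.
rewrite /adjacent eq_sym nvw; apply/existsP; exists F'; rewrite F'w eF'.
by rewrite mem_common subsetDl.
Qed.

Lemma opposite_inj v : {in facets_at v &, injective (opposite v)}.
Proof.
move=> F G Fv Gv eFG; have [nG _] := oppositeP Gv.
have [_ cF] := oppositeP Fv.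
apply/eqP; rewrite eq_sym; apply: contraNT nG => GF; rewrite -eFG.
have : opposite v F \in common (facets_at v :\ F) by rewrite cF !inE eqxx orbT.
by rewrite mem_common => /subsetP/(_ G); rewrite in_setD1 GF Gv mem_facets_at => /(_ isT)/andP[].
Qed.

Lemma mem_common_opposite v F B : B \subset facets_at v -> F \in facets_at v ->
  (opposite v F \in common B) = (F \notin B).
Proof.
move=> Bv Fv; have [nF cF] := oppositeP Fv; apply/idP/idP => [oB|FB].
  apply: contraNN nF => FB; move: oB; rewrite mem_common => /subsetP/(_ _ FB).
  by rewrite mem_facets_at => /andP[].
have : opposite v F \in common (facets_at v :\ F) by rewrite cF !inE eqxx orbT.
rewrite !mem_common; apply: subset_trans; apply/subsetP => G GB.
rewrite in_setD1 (subsetP Bv) // andbT.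
by apply: contraNneq FB => <-.
Qed.

(** The edges at v inside the 2-face common B are those opposite to the two facets
    at v that are not in B. *)
Lemma card_adjacent_common B v : #|B|.+2 = d -> v \in common B ->
  #|[set w in common B | adjacent v w]| = 2.
Proof.
move=> cB vB; have Bv : B \subset facets_at v by rewrite -mem_common.
rewrite [X in #|pred_of_set X|](_ : _ = opposite v @: (facets_at v :\: B)).
  rewrite card_in_imset; last first.
    by move=> F G /setDP[Fv _] /setDP[Gv _]; exact: opposite_inj.
  by rewrite cardsD (setIidPr Bv) card_facets_at -cB -addn2 addKn.
apply/setP => w; rewrite inE; apply/andP/imsetP.
  move=> [wB /adjacentP[F Fv wE]]; exists F => //.
  by rewrite inE Fv andbT -(mem_common_opposite Bv) // -wE.
move=> [F /setDP[Fv FB] ->]; rewrite mem_common_opposite // FB; split => //.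
by apply/adjacentP; exists F.
Qed.

(** Adding the facet h u to B cuts the 2-face common B down to an edge, so the
    fibers of h are pairs of endpoints, and these edges match D perfectly. *)
Lemma matching_even B D (h : V -> {set V}) : #|B|.+2 = d -> D \subset common B ->
  {in D, forall u, h u \in facets_at u :\: B} ->
  {in D, forall u, {in common B, forall w, h u \in facets_at w -> w \in D /\ h w = h u}} ->
  ~~ odd #|D|.
Proof.
move=> cB /subsetP DB hP hD.
rewrite (@card_uniform_partition _ 2 (preim_partition h D) D); last 2 first.
- move=> A /imsetP[u uD ->]; rewrite /pblock.
  have /DB := uD; rewrite mem_common => Bu.
  have /setDP[hu hB] := hP u uD.
  have sub : h u |: B \subset facets_at u by rewrite subUset sub1set hu.
  have /cards1P[F eF] : #|facets_at u :\: (h u |: B)| == 1.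
    by rewrite cardsD (setIidPr sub) card_facets_at cardsU1 hB -cB add1n subSnn.
  have : F \in facets_at u :\: (h u |: B) by rewrite eF set11.
  rewrite in_setD => /andP[_ Fu].
  have [nF cF] := oppositeP Fu.
  have EF : facets_at u :\ F = h u |: B.
    by rewrite -eF setDDr setDv set0U (setIidPr sub).
  have := cards2 u (opposite u F); rewrite -cF.
  have -> : u != opposite u F.
    by apply: contraNneq nF => <-; move: Fu; rewrite mem_facets_at => /andP[].
  move=> <-; apply: eq_card => w; rewrite !inE EF subUset sub1set -(mem_common w B).
  apply/andP/andP => [[wD /eqP ew]|[huw wB]]; first by rewrite DB // ew; have /setDP[] := hP w wD.
  by have [-> ->] := hD u uD w wB huw.
- apply: equivalence_partitionP => x y z _ _ _; split => // /eqP -> //.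
by rewrite muln2 odd_double.
Qed.

Lemma card_codim2 v F G : F \in facets_at v -> G \in facets_at v -> F != G ->
  #|facets_at v :\ F :\ G|.+2 = d.
Proof.
move=> Fv Gv FG; rewrite -(card_facets_at v) (cardsD1 F (facets_at v)) Fv (cardsD1 G (_ :\ F)).
by rewrite in_setD1 Gv eq_sym FG.
Qed.

(** The d colors are all used by the d differently colored facets at v. *)
Lemma colored_facet c D v b : colored_on d D c -> v \in D -> b < d ->
  exists2 F, F \in facets_at v & c F = b.
Proof.
move=> col vD ltb; have [c_lt c_inj] := col v vD.
have uc : uniq (map c (enum (facets_at v))).
  rewrite map_inj_in_uniq ?enum_uniq // => F G; rewrite !mem_enum; exact: c_inj.
have sub : {subset map c (enum (facets_at v)) <= iota 0 d}.
  move=> k /mapP[F]; rewrite mem_enum => Fv ->.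
  by rewrite mem_iota c_lt.
have [|_ eqi] := uniq_min_size uc sub.
  by rewrite size_iota size_map -cardE card_facets_at.
have : b \in map c (enum (facets_at v)) by rewrite eqi mem_iota.
by case/mapP => F; rewrite mem_enum => Fv ->; exists F.
Qed.

(** Each vertex in D lies on a single facet of color b, which cuts the 2-face in an
    edge; the last hypothesis says that this edge does not leave D. *)
Lemma colored_matching_even B D c b : #|B|.+2 = d -> D \subset common B ->
  colored_on d D c -> b < d -> {in B, forall F, c F != b} ->
  (forall u w H, u \in D -> w \in common B -> H \in facets_at u -> H \in facets_at w ->
     c H = b -> w \in D) ->
  ~~ odd #|D|.
Proof.
move=> cB DB col ltb nb clo.
pose h u := odflt set0 [pick H in facets_at u | c H == b].
have hP u : u \in D -> h u \in facets_at u /\ c (h u) = b.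
  move=> uD; rewrite /h; case: pickP => [H /andP[Hu /eqP//]|].
  by have [H Hu /eqP cH] := colored_facet col uD ltb; move=> /(_ H); rewrite /= Hu cH.
apply: (@matching_even B D h) => // [u uD|u uD w wB huw].
  have [hu ch] := hP u uD; rewrite in_setD hu andbT.
  by apply/negP => /nb; rewrite ch eqxx.
have [hu ch] := hP u uD; have wD := clo _ _ _ uD wB hu huw ch.
have [hw ch'] := hP w wD; split => //.
by apply: (col w wD).2 => //; rewrite ch ch'.
Qed.

(** The facets of the color of F do not contain the 2-face, so they cut it in edges
    that match all its vertices in pairs. *)
Lemma colored_even c : colored_on d setT c -> even_2faces.
Proof.
move=> col v F G Fv Gv FG; have cB := card_codim2 Fv Gv FG.
apply: (@colored_matching_even _ _ c (c F) cB) => //.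
- by move=> u _; apply: col; rewrite inE.
- exact: (col v (in_setT v)).1.
move=> H; rewrite !in_setD1 => /and3P[_ HF Hv]; apply: contraNneq HF => cHF.
by apply/eqP; exact: ((col v (in_setT v)).2 _ _ Hv Fv cHF).
Qed.

(** Both sides count the edges of D, each of which has one endpoint in either
    color class. *)
Lemma bipartite_count D (col : V -> bool) : bipartite_on D col ->
  \sum_(u in D | col u) #|[set w in D | adjacent u w]| =
  \sum_(u in D | ~~ col u) #|[set w in D | adjacent u w]|.
Proof.
move=> bip.
have cE b u : u \in D -> col u = b -> #|[set w in D | adjacent u w]| =
    \sum_(w in D | col w == ~~ b) adjacent u w.
  move=> uD cu; rewrite -sum1dep_card [LHS]big_mkcondr [RHS]big_mkcondr /=.
  apply: eq_bigr => w wD; case: ifP => [/(bip _ _ uD wD)|_]; last by case: ifP.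
  by rewrite cu; case: (col w) b cu => -[].
rewrite (eq_bigr _ (fun u uD => cE true u (proj1 (andP uD)) (proj2 (andP uD)))).
rewrite [RHS](eq_bigr (fun u => \sum_(w in D | col w == true) adjacent u w)); last first.
  by move=> u /andP[uD /negPf cu]; rewrite (cE false).
rewrite (exchange_big_dep (fun w => (w \in D) && ~~ col w)) /=; last first.
  by move=> u w _; case: (col w).
apply: eq_bigr => w /andP[wD /negPf cw].
apply: eq_big => [u|u _]; last by rewrite adjacent_sym.
by rewrite wD cw eqxx !andbT eqb_id.
Qed.

(** In a 2-face every vertex has two neighbors, so by double counting the two
    color classes have the same size. *)
Lemma bipartite_even col : bipartite_on setT col -> even_2faces.
Proof.
move=> bip v F G Fv Gv FG; have cB := card_codim2 Fv Gv FG.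
set S := common _.
have := @bipartite_count S col (fun u w _ _ => bip u w (in_setT _) (in_setT _)).
rewrite (eq_bigr (fun=> 2)) => [|u /andP[uS _]]; last exact: card_adjacent_common.
rewrite [RHS](eq_bigr (fun=> 2)) => [|u /andP[uS _]]; last exact: card_adjacent_common.
rewrite !sum_nat_const => /eqP; rewrite eqn_mul2r /= => /eqP e.
by rewrite -sum1_card (bigID col) /= !sum1_card e addnn odd_double.
Qed.

Section Sweep.
Context (R : realDomainType) (f : V -> R) (f_inj : injective f).
Context (lmin : local_min_global f) (lmax : local_min_global (fun v => - f v)%R).
Context (even2 : even_2faces).

Definition below v := [set u | (f u < f v)%R].

Lemma below_closed v : [set u | (f u <= f v)%R] = v |: below v.
Proof. by apply/setP => u; rewrite !inE le_eqVlt (inj_eq f_inj). Qed.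

(** Induction along the sweep: it suffices to add one vertex v at a time to the
    vertices below it. *)
Lemma sweep_ind (Q : {set V} -> Prop) :
  Q set0 -> (forall v, Q (below v) -> Q (v |: below v)) -> Q setT.
Proof.
move=> Q0 QS.
have top (D : {set V}) : (forall u w, u \in D -> (f w < f u)%R -> w \in D) -> Q D.
  have [k] := ubnP #|D|; elim: k D => // k IH D cD dc.
  have [->//|[x xD]] := set_0Vmem D.
  have [v vD vmax] := @Order.TotalTheory.arg_maxP _ _ _ x (mem D) f xD.
  have DE : D = v |: below v.
    apply/setP => u; rewrite -below_closed inE; apply/idP/idP => [/vmax//|].
    by rewrite le_eqVlt (inj_eq f_inj) => /predU1P[->//|]; exact: dc.
  rewrite DE; apply/QS/IH; last by move=> u w; rewrite !inE => /[swap]; exact: lt_trans.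
  by move: cD; rewrite DE cardsU1 inE ltxx.
by apply: top => u w; rewrite inE.
Qed.

(** The neighbors of v in the 2-face are the endpoints of the two descending edges
    that span it, so v is its highest vertex. *)
Lemma common_below v F G : F \in facets_at v -> G \in facets_at v -> F != G ->
  (f (opposite v F) < f v)%R -> (f (opposite v G) < f v)%R ->
  common (facets_at v :\ F :\ G) :\ v \subset below v.
Proof.
move=> Fv Gv FG lF lG; apply/subsetP => u /setD1P[uv uS].
have sub : facets_at v :\ F :\ G \subset facets_at v.
  by rewrite (subset_trans (subsetDl _ _)) ?subsetDl.
rewrite inE lt_neqAle (inj_eq f_inj) uv /= -lerN2.
apply: lmax uS => // w /adjacentP[H Hv ->].
rewrite mem_common_opposite // !in_setD1 Hv andbT negb_and !negbK lerN2.
by case/orP => /eqP->; exact: ltW.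
Qed.

Lemma even_common_below v F G : F \in facets_at v -> G \in facets_at v -> F != G ->
  odd #|common (facets_at v :\ F :\ G) :\ v|.
Proof.
move=> Fv Gv FG; have := even2 Fv Gv FG; rewrite (cardsD1 v) mem_common.
by rewrite (subset_trans (subsetDl _ _)) ?subsetDl //= negbK.
Qed.

(** The lower neighbors of v determine its color.  Two of them cannot disagree, as a
    double count of edges in the 2-face that they span with v shows. *)
Lemma even_bipartite : exists col, bipartite_on setT col.
Proof.
apply: (@sweep_ind (fun D => exists col, bipartite_on D col)) => [|v [col bip]]; first by exists predT => u w; rewrite inE.
suff mono : {in [pred u | adjacent v u & u \in below v] &, forall u w, col u = col w}.
  pose b := [exists u in below v, adjacent v u && col u].
  have bP u : u \in below v -> adjacent v u -> b = col u.
    move=> ub vu; apply/existsP/idP => [[w /and3P[wb vw]]|cu]; last by exists u; rewrite ub vu.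
    by rewrite (@mono w u) // inE ?vu ?vw.
  exists (fun u => if u == v then ~~ b else col u).
  have nv u : u \in below v -> (u == v) = false.
    by rewrite inE; apply: contraTF => /eqP->; rewrite ltxx.
  move=> u w /setU1P[->|ub] /setU1P[->|wb]; rewrite ?eqxx ?nv //.
  - by rewrite /adjacent eqxx.
  - by move/bP => ->//; case: (col w).
  - by rewrite adjacent_sym => /bP-> //; case: (col u).
  - exact: bip.
move=> _ _ /andP[/= /adjacentP[F Fv ->] bF] /andP[/= /adjacentP[G Gv ->] bG].
have [->//|FG] := eqVneq F G; apply/eqP; apply: contraT => ncol.
have cB := card_codim2 Fv Gv FG; set B := _ :\ F :\ G in cB.
have sub : B \subset facets_at v by rewrite (subset_trans (subsetDl _ _)) ?subsetDl.
rewrite !inE in bF bG.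
have Db := common_below Fv Gv FG bF bG; have := even_common_below Fv Gv FG.
rewrite -/B in Db *; set D := common B :\ v in Db *.
have memF : opposite v F \in common B by rewrite mem_common_opposite // !in_setD1 eqxx andbF.
have memG : opposite v G \in common B by rewrite mem_common_opposite // !in_setD1 eqxx.
have nFG : opposite v F != opposite v G.
  by apply: contraNneq ncol => ->.
have bD : bipartite_on D col by move=> u w /(subsetP Db) ? /(subsetP Db) ?; exact: bip.
have nvP H : H \in facets_at v -> opposite v H != v.
  by move=> Hv; rewrite eq_sym; case/andP: (introT (adjacentP v _) (ex_intro2 _ _ H Hv erefl)).
(* The two neighbors of v in its 2-face have only one neighbor in D each, the
   other vertices of D have two.  As the two exceptions are in different color
   classes, the classes are of equal size. *)
have deg u : u \in D -> #|[set w in D | adjacent u w]| +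
    ((u == opposite v F) + (u == opposite v G)) = 2.
  move=> /setD1P[uv uB]; rewrite -(card_adjacent_common cB uB).
  rewrite [RHS](cardsD1 v) addnC inE mem_common sub /=; congr (_ + _).
    rewrite adjacent_sym.
    case: (u =P opposite v F) => [->|nF].
      by rewrite (negPf nFG); apply/esym/eqP; rewrite eqb1; apply/adjacentP; exists F.
    case: (u =P opposite v G) => [->|nG].
      by apply/esym/eqP; rewrite eqb1; apply/adjacentP; exists G.
    apply/esym/eqP; rewrite eqb0; apply/negP => /adjacentP[H Hv uE].
    move: uB; rewrite uE mem_common_opposite // !in_setD1 Hv andbT negb_and !negbK.
    by case/orP => /eqP eH; move: nF nG; rewrite uE eH.
  by apply: eq_card => w; rewrite !inE andbA.
have FD : opposite v F \in D by rewrite in_setD1 nvP.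
have GD : opposite v G \in D by rewrite in_setD1 nvP.
have sumb (p : pred V) x : x \in D -> \sum_(u in D | p u) (u == x) = p x.
  move=> xD; case: (boolP (p x)) => px.
    rewrite (bigD1 x) /= ?xD // eqxx big1 ?addn0 // => u /andP[_ /negPf->//].
  rewrite big1 // => u /andP[_ pu]; apply/eqP; rewrite eqb0.
  by apply: contraNneq px => <-.
have dsum (p : pred V) : \sum_(u in D | p u) #|[set w in D | adjacent u w]| +
    (p (opposite v F) + p (opposite v G)) = 2 * \sum_(u in D | p u) 1.
  rewrite big_distrr /= -(sumb p _ FD) -(sumb p _ GD) -!big_split /=.
  by apply: eq_bigr => u /andP[/deg].
have count_col (p : pred V) : p (opposite v F) != p (opposite v G) ->
    \sum_(u in D | p u) #|[set w in D | adjacent u w]| + 1 = 2 * \sum_(u in D | p u) 1.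
  by rewrite -dsum; case: (p _); case: (p _).
have := count_col col ncol; rewrite bipartite_count //= count_col; last first.
  by rewrite /= (inj_eq negb_inj).
move=> /eqP; rewrite eqn_mul2l /= => /eqP e.
by rewrite -sum1_card (bigID col) /= -e addnn odd_double.
Qed.

(** The d - 2 facets containing the 2-face and F leave one color unused. *)
Lemma colored_missing (c : {set V} -> nat) v F G :
  F \in facets_at v -> G \in facets_at v -> F != G ->
  exists b, [/\ b < d, c F != b & {in facets_at v :\ F :\ G, forall H, c H != b}].
Proof.
move=> Fv Gv FG; pose s := c F :: map c (enum (facets_at v :\ F :\ G)).
have [/allP sub|/allPn[b]] := boolP (all (mem s) (iota 0 d)).
  have := uniq_leq_size (iota_uniq 0 d) sub.
  by rewrite size_iota /= size_map -cardE -(card_codim2 Fv Gv FG) ltnn.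
rewrite mem_iota /= add0n inE negb_or eq_sym => bd /andP[bF bs]; exists b; split => // H HB.
by apply: contraNneq bs => <-; apply: map_f; rewrite mem_enum.
Qed.

(** All neighbors of v inside F lie above v, so v is the lowest vertex of F: such a
    facet is not yet colored when v is reached. *)
Lemma lowest_vertex_facet v F u : F \in facets_at v ->
  (forall G, G \in facets_at v -> G != F -> (f v < f (opposite v G))%R) ->
  u \in below v -> F \notin facets_at u.
Proof.
move=> Fv up; rewrite inE; apply: contraTN => Fu; rewrite -leNgt.
apply: (@lmin v [set F]); rewrite ?sub1set ?mem_common ?sub1set // => w.
move=> /adjacentP[G Gv ->]; rewrite mem_common_opposite ?sub1set // in_set1 => GF.
exact: ltW (up _ Gv GF).
Qed.

(** If F and G had the same color, some color b would be missing at v.  Then the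
    edges of the 2-face on facets of color b would match its vertices below v in
    pairs, but their number is odd. *)
Lemma top_facets_colored_apart v c F G : colored_on d (below v) c ->
  F \in facets_at v -> G \in facets_at v -> F != G ->
  (f (opposite v F) < f v)%R -> (f (opposite v G) < f v)%R -> c F != c G.
Proof.
move=> col Fv Gv FG lF lG; have := even_common_below Fv Gv FG.
apply: contraTneq => cFG; have cB := card_codim2 Fv Gv FG.
have /subsetP Db := common_below Fv Gv FG lF lG.
have [b [ltb nFb nb]] := colored_missing c Fv Gv FG.
set B := _ :\ F :\ G in cB Db nb *.
apply: (@colored_matching_even B _ c b) => //; first exact: subsetDl.
  by move=> u /Db; exact: col.
move=> u w H /setD1P[uv uB] wB Hu Hw cH; rewrite in_setD1 wB andbT.
apply/eqP => wv; rewrite {}wv in Hw.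
have : H \notin B by apply/negP => /nb; rewrite cH eqxx.
rewrite !in_setD1 Hw andbT negb_and !negbK.
by case/orP => /eqP eH; move: nFb; rewrite -cH eH ?cFG eqxx.
Qed.

(** By the number of lower neighbors of v.  With none, all facets at v are new.
    With one, reached by leaving F0, only F0 is new and inherits the color of the
    facet that replaces it at the lower neighbor.  With at least two, no facet is
    new; two facets that share no lower neighbor of v are those left by its only
    two descending edges. *)
Lemma even_colored : exists c, colored_on d setT c.
Proof.
apply: (@sweep_ind (fun D => exists c, colored_on d D c)) => [|v [c col]].
  by exists (fun=> 0) => u; rewrite inE.
have extend (c' : {set V} -> nat) : {in below v, forall u, {in facets_at u, c' =1 c}} ->
    {in facets_at v, forall F, c' F < d} -> {in facets_at v &, injective c'} ->
    colored_on d (v |: below v) c'.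
  move=> ec c'_lt c'_inj u /setU1P[->//|ub]; have [c_lt c_inj] := col u ub.
  split=> [F Fu|F G Fu Gu]; first by rewrite (ec u ub) // c_lt.
  by rewrite !(ec u ub) //; exact: c_inj.
have opne G : G \in facets_at v -> f (opposite v G) != f v.
  move=> Gv; rewrite (inj_eq f_inj) eq_sym.
  by case/andP: (introT (adjacentP v _) (ex_intro2 _ _ G Gv erefl)).
(* The facets left by the descending edges at v *)
pose K := [set F in facets_at v | (f (opposite v F) < f v)%R].
have upK G : G \in facets_at v -> G \notin K -> (f v < f (opposite v G))%R.
  by move=> Gv; rewrite inE Gv /= -leNgt lt_def opne.
have [K0|[F0 F0K]] := set_0Vmem K.
  exists (fun F => if F \in facets_at v then index F (enum (facets_at v)) else c F).
  apply: extend => [u ub F Fu|F Fv|F G Fv Gv].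
  - case: ifP => // Fv; suff : F \notin facets_at u by rewrite Fu.
    by apply: lowest_vertex_facet ub => // G Gv _; apply: upK => //; rewrite K0 inE.
  - by rewrite Fv -(card_facets_at v) cardE index_mem mem_enum.
  - by rewrite Fv Gv; apply: (index_inj F); rewrite mem_enum.
have /setIdP[F0v lF0] := F0K.
have ub0 : opposite v F0 \in below v by rewrite inE.
have [c_lt c_inj] := col _ ub0.
have memo F G : F \in facets_at v -> F != G -> G \in facets_at v -> F \in facets_at (opposite v G).
  move=> Fv FG Gv; have := mem_common_opposite (B := [set F]) (v := v) (F := G).
  by rewrite !sub1set mem_common sub1set in_set1 eq_sym FG => ->.
have [KF0|[F1]] := set_0Vmem (K :\ F0).
  have [F' [F'u nF'v F'E]] := opposite_exchange F0v.
  have F'N G : G \in facets_at v -> G != F0 ->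
      G \in facets_at (opposite v F0) /\ G != F'.
    by move=> Gv GF0; split; [exact: memo | apply: contraNneq nF'v => <-].
  exists (fun F => if F == F0 then c F' else c F).
  apply: extend => [u ub F Fu|F Fv|F G Fv Gv].
  - case: eqP => // eF; suff : F \notin facets_at u by rewrite Fu.
    rewrite eF; apply: lowest_vertex_facet ub => // G Gv GF0; apply: upK => //.
    by apply/negP => GK; have := in_set0 G; rewrite -KF0 in_setD1 GF0 GK.
  - by case: eqVneq => [_|/(F'N _ Fv)[Fu _]]; exact: c_lt.
  case: eqVneq => [->|/(F'N _ Fv)[Fu FF']]; case: eqVneq => [->//|/(F'N _ Gv)[Gu GF']].
  - by move/(c_inj _ _ F'u Gu)/eqP; rewrite eq_sym (negPf GF').
  - by move/(c_inj _ _ Fu F'u)/eqP; rewrite (negPf FF').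
  - exact: c_inj.
move=> /setD1P[F10 F1K].
have /setIdP[F1v lF1] := F1K.
have commonK F G H : H \in K -> F \in facets_at v -> G \in facets_at v ->
    F != H -> G != H -> c F = c G -> F = G.
  move=> /setIdP[Hv lH] Fv Gv FH GH; have [|_ H_inj] := col (opposite v H); first by rewrite inE.
  by apply: H_inj; exact: memo.
exists c; apply: extend => // [F Fv|F G Fv Gv].
  have [FF0|FF0] := eqVneq F F0; last by apply: c_lt; exact: memo.
  have ub1 : opposite v F1 \in below v by rewrite inE.
  by apply: (col _ ub1).1; apply: memo => //; rewrite FF0 eq_sym.
have [//|FG] := eqVneq F G => /eqP; apply: contraTeq => _.
have inK H : H \in K -> c F = c G -> (H == F) || (H == G).
  move=> HK cFG; apply: contraNT FG; rewrite negb_or ![H == _]eq_sym => /andP[FH GH].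
  by apply/eqP; exact: commonK HK Fv Gv FH GH cFG.
apply/eqP => cFG; have := inK _ F0K cFG; have := inK _ F1K cFG.
have FK : F \in K -> G \in K -> False.
  move=> /setIdP[_ lF] /setIdP[_ lG]; have := top_facets_colored_apart col Fv Gv FG lF lG.
  by rewrite cFG eqxx.
case/orP => /eqP e1; case/orP => /eqP e0; rewrite e1 e0 in F10 F0K F1K *.
- by rewrite eqxx in F10.
- exact: FK.
- exact: FK.
- by rewrite eqxx in F10.
Qed.

End Sweep.

End Simple.
End Incidence.

Local Open Scope classical_set_scope.
Local Open Scope ring_scope.
Local Open Scope card_scope.

(** * Convex hulls and separation *)

Section Dot.
Context {R : realType} {n : nat}.
Implicit Types (x y z a : 'rV[R]_n).

Lemma dotE x y : dot x y = \sum_i x 0 i * y 0 i.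
Proof. by rewrite /dot mxE; apply: eq_bigr => i _; rewrite mxE. Qed.

Lemma dotC x y : dot x y = dot y x.
Proof. by rewrite !dotE; apply: eq_bigr => i _; rewrite mulrC. Qed.

Lemma dotDl x y a : dot (x + y) a = dot x a + dot y a.
Proof. by rewrite /dot mulmxDl mxE. Qed.

Lemma dotNl x a : dot (- x) a = - dot x a.
Proof. by rewrite /dot mulNmx mxE. Qed.

Lemma dotBl x y a : dot (x - y) a = dot x a - dot y a.
Proof. by rewrite dotDl dotNl. Qed.

Lemma dotZl k x a : dot (k *: x) a = k * dot x a.
Proof. by rewrite /dot -scalemxAl mxE. Qed.

Lemma dot0l a : dot 0 a = 0.
Proof. by rewrite /dot mul0mx mxE. Qed.

Lemma dot_suml I (r : seq I) (Q : pred I) (v : I -> 'rV[R]_n) a :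
  dot (\sum_(i <- r | Q i) v i) a = \sum_(i <- r | Q i) dot (v i) a.
Proof. by rewrite /dot mulmx_suml summxE. Qed.

Lemma dotDr x y a : dot a (x + y) = dot a x + dot a y.
Proof. by rewrite dotC dotDl !(dotC a). Qed.

Lemma dotNr x a : dot a (- x) = - dot a x.
Proof. by rewrite dotC dotNl (dotC a). Qed.

Lemma dotBr x y a : dot a (x - y) = dot a x - dot a y.
Proof. by rewrite dotDr dotNr. Qed.

Lemma dotZr k x a : dot a (k *: x) = k * dot a x.
Proof. by rewrite dotC dotZl (dotC a). Qed.

Lemma dot0r a : dot a 0 = 0.
Proof. by rewrite dotC dot0l. Qed.

Lemma dot_sumr I (r : seq I) (Q : pred I) (v : I -> 'rV[R]_n) a :
  dot a (\sum_(i <- r | Q i) v i) = \sum_(i <- r | Q i) dot a (v i).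
Proof. by rewrite dotC dot_suml; apply: eq_bigr => i _; rewrite dotC. Qed.

Lemma dot_ge0 x : 0 <= dot x x.
Proof. by rewrite dotE; apply: sumr_ge0 => i _; rewrite -expr2 sqr_ge0. Qed.

Lemma dot_eq0 x : dot x x = 0 -> x = 0.
Proof.
rewrite dotE => /eqP; rewrite psumr_eq0 => [|i _]; last by rewrite -expr2 sqr_ge0.
move=> /allP x0; apply/rowP => i; rewrite mxE; apply/eqP.
by have := x0 i (mem_index_enum i); rewrite /= mulf_eq0 orbb.
Qed.

Lemma dot_gt0 x : x != 0 -> 0 < dot x x.
Proof. by move=> x0; rewrite lt_def dot_ge0 andbT; apply: contraNneq x0 => /dot_eq0->. Qed.

Lemma dot_subZ a x (s : R) :
  dot (a - s *: x) (a - s *: x) = dot a a - s * (2 * dot a x - s * dot x x).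
Proof. by rewrite dotBl !dotBr !dotZl !dotZr (dotC x a); ring. Qed.

End Dot.

Section Hull.
Context {R : realType} {n : nat}.
Implicit Types (x y z a : 'rV[R]_n).

Lemma convex_combB (I : finType) (w : I -> R) (v : I -> 'rV[R]_n) x :
  \sum_i w i = 1 -> \sum_i w i *: v i - x = \sum_i w i *: (v i - x).
Proof.
move=> w1; rewrite -{1}[x]scale1r -w1 scaler_suml -sumrB.
by apply: eq_bigr => i _; rewrite scalerBr.
Qed.

(** A weighted mean of terms bounded by b reaches b only if every term of nonzero
    weight does: the reason why a face contains, with a point, all the generators
    that the point involves. *)
Lemma wmean_max (I : finType) (w g : I -> R) (b : R) :
  (forall i, 0 <= w i) -> \sum_i w i = 1 -> (forall i, w i != 0 -> g i <= b) ->
  \sum_i w i * g i = b -> forall i, w i != 0 -> g i = b.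
Proof.
move=> w0 w1 gb e i wi.
have ge0 j : 0 <= w j * (b - g j).
  have [->|wj] := eqVneq (w j) 0; first by rewrite mul0r.
  by rewrite mulr_ge0 // subr_ge0 gb.
have : \sum_j w j * (b - g j) = 0.
  under eq_bigr do rewrite mulrBr.
  by rewrite sumrB e -mulr_suml w1 mul1r subrr.
move/eqP; rewrite psumr_eq0 // => /allP/(_ i); rewrite mem_index_enum => /(_ isT).
by rewrite /= mulf_eq0 (negPf wi) /= subr_eq0 => /eqP.
Qed.

Lemma some_weight_neq0 (I : finType) (w : I -> R) : \sum_i w i = 1 -> exists i, w i != 0.
Proof.
move=> w1; case: (pickP (fun i => w i != 0)) => [i wi|w0]; first by exists i.
by move: w1; rewrite big1 => [/eqP|i _]; [rewrite eq_sym oner_eq0 | apply/eqP/negbFE/w0].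
Qed.

Lemma hull_gen m (v : 'I_m -> 'rV[R]_n) i : convex_hull v (v i).
Proof.
exists (fun j => (j == i)%:R); split => [j||]; first exact: ler0n.
  by rewrite (bigD1 i) //= eqxx big1 ?addr0 // => j /negPf->.
by rewrite (bigD1 i) //= eqxx scale1r big1 ?addr0 // => j /negPf->; rewrite scale0r.
Qed.

Lemma hull_sum m (v : 'I_m -> 'rV[R]_n) (I : finType) (w : I -> R) (u : I -> 'rV[R]_n) :
  (forall i, 0 <= w i) -> \sum_i w i = 1 -> (forall i, convex_hull v (u i)) ->
  convex_hull v (\sum_i w i *: u i).
Proof.
move=> w0 w1 uv; pose c i := sval (cid (uv i)).
have cP i : [/\ forall j, 0 <= c i j, \sum_j c i j = 1 & u i = \sum_j c i j *: v j].
  by rewrite /c; case: cid.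
exists (fun j => \sum_i w i * c i j); split.
- by move=> j; apply: sumr_ge0 => i _; rewrite mulr_ge0 //; have [] := cP i.
- rewrite exchange_big -[RHS]w1; apply: eq_bigr => i _.
  by rewrite -mulr_sumr; have [_ -> _] := cP i; rewrite mulr1.
- under [RHS]eq_bigr do rewrite scaler_suml.
  rewrite exchange_big; apply: eq_bigr => i _; have [_ _ ->] := cP i.
  by rewrite scaler_sumr; apply: eq_bigr => j _; rewrite scalerA.
Qed.

Lemma hull_subset m k (v : 'I_m -> 'rV[R]_n) (u : 'I_k -> 'rV[R]_n) :
  (forall i, convex_hull v (u i)) -> convex_hull u `<=` convex_hull v.
Proof. by move=> uv x [w [w0 w1 ->]]; exact: hull_sum. Qed.

Lemma hull_conv2 m (v : 'I_m -> 'rV[R]_n) x y (s : R) :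
  convex_hull v x -> convex_hull v y -> 0 <= s <= 1 ->
  convex_hull v (x + s *: (y - x)).
Proof.
move=> vx vy /andP[s0 s1].
have := @hull_sum m v bool (fun b => if b then s else 1 - s) (fun b => if b then y else x).
rewrite !big_bool /= subrKC.
have -> : s *: y + (1 - s) *: x = x + s *: (y - x).
  by rewrite scalerBl scalerBr scale1r addrCA addrA.
by apply => //; case=> //; rewrite subr_ge0.
Qed.

Lemma hull_dot_le m (v : 'I_m -> 'rV[R]_n) a (b : R) :
  (forall i, dot a (v i) <= b) -> forall x, convex_hull v x -> dot a x <= b.
Proof.
move=> vb x [w [w0 w1 ->]]; rewrite dot_sumr -[b]mul1r -w1 mulr_suml.
by apply: ler_sum => i _; rewrite dotZr ler_wpM2l.
Qed.

Lemma continuous_dot_self m (g : 'rV[R]_m -> 'rV[R]_n) :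
  (forall i, continuous (fun w => g w 0 i)) -> continuous (fun w => dot (g w) (g w)).
Proof.
move=> cg w; have nw := nbhs_filter w; rewrite (_ : (fun w => _) = fun w => \sum_i g w 0 i * g w 0 i); last first.
  by apply/funext => u; rewrite dotE.
by apply: (@cvg_big R _ _ _ _ add_continuous) => i _; exact: (cvgM (cg i w) (cg i w)).
Qed.

Lemma simplex_compact m :
  compact [set w : 'rV[R]_m | (forall i, 0 <= w 0 i) /\ \sum_i w 0 i = 1].
Proof.
apply: (@subclosed_compact _ _ [set w : 'rV[R]_m | forall i, `[0, 1]%classic (w ord0 i)]).
- rewrite [X in closed X](_ : _ =
      \bigcap_i [set w : 'rV[R]_m | 0 <= w 0 i] `&` [set w | \sum_i w 0 i = 1]); last first.
    by apply/seteqP; split => w [w0 w1]; split => // i; [move=> _; exact: w0 | exact: (w0 i I)].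
  apply: closedI.
    apply: closed_bigI => i _.
    apply: (preimage_closed _ (@closed_ge R 0)) => w _; exact: coord_continuous.
  apply: (preimage_closed _ (@closed_eq R 1)) => w _; have nw := nbhs_filter w.
  by apply: (@cvg_big R _ _ _ _ add_continuous) => i _; exact: coord_continuous.
- by apply: (@rV_compact R m (fun=> `[0, 1]%classic)) => i; exact: segment_compact.
move=> w [w0 w1] i; rewrite /= in_itv /= w0 -w1 (bigD1 i) //= lerDl.
by apply: sumr_ge0.
Qed.

(** The hyperplane is perpendicular to the segment from x to the point q of the
    hull nearest to x; if it did not separate x from y, moving q slightly towards y
    would come closer to x. *)
Lemma separation m (v : 'I_m -> 'rV[R]_n) x : ~ convex_hull v x ->
  exists a (t : R), (forall y, convex_hull v y -> dot a y < t) /\ t < dot a x.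
Proof.
move=> nx.
pose K := [set w : 'rV[R]_m | (forall i, 0 <= w 0 i) /\ \sum_i w 0 i = 1].
pose pt (w : 'rV[R]_m) := \sum_i w 0 i *: v i.
have ptP y : convex_hull v y -> exists2 w, K w & y = pt w.
  move=> [c [c0 c1 ->]]; exists (\row_i c i).
    by split=> [i|]; [rewrite mxE | rewrite -c1; apply: eq_bigr => i _; rewrite mxE].
  by apply: eq_bigr => i _; rewrite mxE.
have Kpt w : K w -> convex_hull v (pt w) by move=> [w0 w1]; exists (fun i => w 0 i).
have [K0|/set0P Kn] := eqVneq K set0.
  exists 0, (-1); rewrite dot0l oppr_lt0 ltr01; split => // y /ptP[w Kw].
  by rewrite K0 in Kw.
have cont : {within K, continuous (fun w => dot (x - pt w) (x - pt w))}.
  apply: continuous_subspaceT; apply: continuous_dot_self => i.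
  have -> : (fun w : 'rV[R]_m => (x - pt w) 0 i) =
      fun w => x 0 i - \sum_j w 0 j * v j 0 i.
    by apply/funext => w; rewrite !mxE summxE; congr (_ - _); apply: eq_bigr => j _; rewrite mxE.
  move=> w; have nw := nbhs_filter w; apply: cvgB; first exact: cvg_cst.
  apply: (@cvg_big R _ _ _ _ add_continuous) => j _; apply: cvgM; last exact: cvg_cst.
  exact: coord_continuous.
have [w0 /set_mem Kw0 wmin] := EVT_min_rV Kn (@simplex_compact m) cont.
set q := pt w0 in wmin; have hq : convex_hull v q := Kpt _ Kw0.
pose a := x - q; have a_gt0 : 0 < dot a a.
  by apply: dot_gt0; rewrite subr_eq0; apply: contraPneq hq => <-.
exists a, (dot a q + dot a a / 2); split; last first.
  rewrite -(subrK q x) -/a (dotDr a q a) addrC ltrD2r.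
  by rewrite gtr_pMr // invf_lt1 // ltr1n.
move=> y hy; apply: le_lt_trans (_ : dot a q < _); last by rewrite ltrDl divr_gt0.
rewrite leNgt -subr_gt0 -dotBr; apply/negP; set p := y - q; set e := dot a p => e_gt0.
have N0 := dot_ge0 p; set N := dot p p in N0.
have eN : 0 < e + N by rewrite ltr_wpDr.
(* Any s with 0 < s <= 1 and s * N < 2 * e would do. *)
pose s := e / (e + N).
have s01 : 0 <= s <= 1.
  apply/andP; split; first exact/divr_ge0/ltW/eN/ltW.
  by rewrite /s ler_pdivrMr // mul1r lerDl.
have [w Kw wE] := ptP _ (hull_conv2 hq hy s01).
have := wmin w (mem_set Kw); rewrite -wE -/p opprD addrA -/a.
have -> : dot (a - s *: p) (a - s *: p) = dot a a - s * (2 * e - s * N).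
  exact: dot_subZ.
rewrite lerBrDr gerDl leNgt => /negP; apply; rewrite mulr_gt0 ?divr_gt0 //.
rewrite subr_gt0 /s mulrAC ltr_pdivrMr //.
have := mulr_ge0 (ltW e_gt0) N0; have := mulr_gt0 e_gt0 e_gt0; nra.
Qed.
End Hull.

(** * Affine hulls and dimension *)

Section Dimension.
Context {R : realType} {n : nat}.
Implicit Types (x y z a : 'rV[R]_n) (A B : set 'rV[R]_n).

Lemma affine_hull_gen A : A `<=` affine_hull A.
Proof.
move=> x Ax; exists 1%N, (fun=> x), (fun=> 1); split => //; rewrite big_ord1 //.
by rewrite scale1r.
Qed.

Lemma affine_hullS A B : A `<=` B -> affine_hull A `<=` affine_hull B.
Proof. by move=> AB x [m [v [w [vA w1 xE]]]]; exists m, v, w; split => // i; exact: AB. Qed.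

Lemma affine_hull_dot A a (b : R) :
  (forall y, A y -> dot a y = b) -> forall y, affine_hull A y -> dot a y = b.
Proof.
move=> Ab y [m [v [w [vA w1 ->]]]]; rewrite dot_sumr -[RHS]mul1r -w1 mulr_suml.
by apply: eq_bigr => i _; rewrite dotZr Ab.
Qed.

Lemma affine_hull_submx A x k (E : 'M[R]_(k, n)) :
  (forall y, A y -> (y - x <= E)%MS) -> forall y, affine_hull A y -> (y - x <= E)%MS.
Proof.
move=> AE y [m [v [w [vA w1 ->]]]]; rewrite convex_combB //.
by apply: summx_sub => i _; rewrite scalemx_sub ?AE.
Qed.

(** A set that contains x and the points x + e_i, and lies in the affine space
    that they span, generates that space. *)
Lemma affine_hull_mx A x k (E : 'M[R]_(k, n)) : A x -> (forall i, A (x + row i E)) ->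
  (forall y, A y -> (y - x <= E)%MS) -> affine_hull A = [set y | (y - x <= E)%MS].
Proof.
move=> Ax AE sub; apply/seteqP; split => y /=; first exact: affine_hull_submx.
move=> /submxP[r /(canRL (subrK _)) ->].
exists k.+1, (fun i => if unlift ord0 i is Some j then x + row j E else x),
  (fun i => if unlift ord0 i is Some j then r 0 j else 1 - \sum_j r 0 j); split.
- by move=> i; case: unliftP.
- rewrite big_ord_recl unlift_none -[RHS](subrK (\sum_j r 0 j)); congr (_ + _).
  by apply: eq_bigr => j _; rewrite liftK.
rewrite addrC big_ord_recl unlift_none scalerBl scale1r -addrA; congr (_ + _).
rewrite mulmx_sum_row scaler_suml addrC -sumrB; apply: eq_bigr => j _.
by rewrite liftK scalerDr addrAC subrr add0r.
Qed.

Lemma has_dim_mx A x k (E : 'M[R]_(k, n)) : row_free E -> A x -> (forall i, A (x + row i E)) ->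
  (forall y, A y -> (y - x <= E)%MS) -> has_dim A k.
Proof.
move=> Efree Ax AE sub; pose f := linfun (mulmxr E : 'rV[R]_k -> 'rV[R]_n).
have fE r : f r = r *m E by rewrite lfunE.
exists x, (limg f); split.
  rewrite (affine_hull_mx Ax AE sub); apply/seteqP; split => y /=.
    by move=> /submxP[r ->]; rewrite -fE memv_img ?memvf.
  by move=> /memv_imgP[r _ ->]; rewrite fE submxMl.
rewrite limg_dim_eq ?dimvf ?dim_matrix ?mul1r //.
apply/eqP; rewrite capfv; apply/lker0P => r s; rewrite !fE => /eqP.
by rewrite -subr_eq0 -mulmxBl mulmx_free_eq0 // subr_eq0 => /eqP.
Qed.

Lemma has_dim_sub A B k l : has_dim A k -> has_dim B l -> A `<=` B ->
  (k <= l)%N /\ (k = l -> affine_hull A = affine_hull B).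
Proof.
move=> [x [U [AE dU]]] [y [W [BE dW]]] /affine_hullS AB.
have xB : x - y \in W.
  by have : affine_hull B x by [apply: AB; rewrite AE /= subrr mem0v]; rewrite BE.
have UW : (U <= W)%VS.
  apply/subvP => u uU; have : affine_hull B (x + u) by apply: AB; rewrite AE /= addrAC subrr add0r.
  rewrite BE /= => uW; rewrite -(addrK (x - y) u) memvB // addrC.
  by rewrite -addrA (addrC (- y)) addrA.
split=> [|kl]; first by rewrite -dU -dW dimvS.
have WU : W = U by apply/eqP; rewrite eq_sym eqEdim UW dU dW kl /=.
apply/seteqP; split=> // u; rewrite AE BE WU /= => uy; rewrite -(subrK y u) -addrA.
by rewrite memvD // -opprB memvN -WU.
Qed.

Lemma has_dim_uniq A k l : has_dim A k -> has_dim A l -> k = l.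
Proof.
move=> dk dl; apply/eqP.
by rewrite eqn_leq (has_dim_sub dk dl _).1 // (has_dim_sub dl dk _).1.
Qed.

Lemma has_dim_nonempty A k : has_dim A k -> A !=set0.
Proof.
move=> [x [U [AE _]]]; have : affine_hull A x by rewrite AE /= subrr mem0v.
by move=> [m [v [w [vA w1 _]]]]; have [i _] := some_weight_neq0 w1; exists (v i).
Qed.

End Dimension.

(** * Vertices and faces of a polytope *)

Section Vertices.
Context {R : realType} {n : nat}.
Implicit Types (x y z a : 'rV[R]_n) (P F G : set 'rV[R]_n).

Definition strictly_exposed m (v : 'I_m -> 'rV[R]_n) :=
  forall i, exists a (t : R), t < dot a (v i) /\ forall j, j != i -> dot a (v j) < t.

(** A minimal family of generators will do: a generator that could not be separated
    from the others would be in their convex hull, hence superfluous. *)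
Lemma polytope_vertices P : polytope P ->
  exists (m : nat) (v : 'I_m -> 'rV[R]_n), P = convex_hull v /\ strictly_exposed v.
Proof.
move=> polyP.
have ex : exists m, `[< exists v : 'I_m -> 'rV[R]_n, P = convex_hull v >].
  by have [m Pv] := polyP; exists m; apply/asboolP.
case: (ex_minnP ex) => m /asboolP[v PE] mmin; exists m, v; split => // i.
case: m => [|m] in v PE mmin i *; first by case: i.
have [hi|/separation[a [t [at_lt lt_a]]]] := pselect (convex_hull (v \o lift i) (v i)).
  suff : (m.+1 <= m)%N by rewrite ltnn.
  apply: mmin; apply/asboolP; exists (v \o lift i); rewrite PE; apply/seteqP; split.
    by apply: hull_subset => j; case: (unliftP i j) => [k ->|->//]; exact: (hull_gen (v \o lift i)).
  by apply: hull_subset => k; exact: hull_gen.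
exists a, t; split => // j; case: (unliftP i j) => [k -> _|->]; last by rewrite eqxx.
by apply: at_lt; exact: (hull_gen (v \o lift i)).
Qed.

Lemma face_sub P F : face P F -> F `<=` P.
Proof. by move=> [a [b [_ ->]]] x []. Qed.

Lemma face_refl P : face P P.
Proof. by exists 0, 0; split=> [x _|]; [rewrite dot0l | rewrite setIidl // => x _; exact: dot0l]. Qed.

Context {m : nat} (v : 'I_m -> 'rV[R]_n).
Let P := convex_hull v.

Lemma face_weights F (w : 'I_m -> R) : face P F ->
  (forall i, 0 <= w i) -> \sum_i w i = 1 ->
  F (\sum_i w i *: v i) <-> forall i, w i != 0 -> F (v i).
Proof.
move=> [a [b [Pab ->]]] w0 w1; split=> [[_ /= e] i wi|wF].
  split; first exact: hull_gen.
  apply: (wmean_max w0 w1 (g := fun i => dot a (v i)) (b := b)) wi => [j _|].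
    exact/Pab/hull_gen.
  by rewrite -e dot_sumr; apply: eq_bigr => j _; rewrite dotZr.
split; first by exists w.
rewrite /= dot_sumr -[RHS]mul1r -w1 mulr_suml; apply: eq_bigr => i _; rewrite dotZr.
by have [->|/wF[_ /= ->]//] := eqVneq (w i) 0; rewrite !mul0r.
Qed.

Lemma face_has_vertex F x : face P F -> F x -> exists i, F (v i).
Proof.
move=> fF Fx; have [w [w0 w1 xE]] := face_sub fF Fx; rewrite xE in Fx.
have [i wi] := some_weight_neq0 w1; exists i.
exact: (face_weights fF w0 w1).1 Fx i wi.
Qed.

Lemma face_subset F G : face P F -> face P G ->
  (forall i, F (v i) -> G (v i)) -> F `<=` G.
Proof.
move=> fF fG FG x Fx; have [w [w0 w1 xE]] := face_sub fF Fx; rewrite xE in Fx *.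
by apply/(face_weights fG w0 w1) => i wi; apply: FG; apply: (face_weights fF w0 w1).1 Fx i wi.
Qed.

Lemma meeting_faces F G : face P F -> face P G -> F `&` G !=set0 ->
  exists i, F (v i) /\ G (v i).
Proof.
move=> fF fG [x [Fx Gx]]; have [w [w0 w1 xE]] := face_sub fF Fx.
rewrite xE in Fx Gx; have [i wi] := some_weight_neq0 w1; exists i.
by split; [apply: (face_weights fF w0 w1).1 Fx i wi | apply: (face_weights fG w0 w1).1 Gx i wi].
Qed.

Context (vP : strictly_exposed v).

Lemma strictly_exposed_inj : injective v.
Proof.
move=> i j e; apply/eqP; apply: contraT; rewrite eq_sym => ji.
have [a [t [ti /(_ _ ji)]]] := vP i; rewrite -e => lti.
by have := lt_trans ti lti; rewrite ltxx.
Qed.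

(** The vertices of a face are the generators that it contains, since these are
    exposed even in the whole polytope. *)
Lemma face_vertexP F x : face P F -> vertex (face F) x <-> F x /\ exists i, x = v i.
Proof.
move=> fF; split=> [[a [b [Fab xE]]]|[Fx [i xE]]].
  have [Fx /= axb] : (F `&` [set y | dot a y = b]) x by rewrite -xE.
  split=> //; have [w [w0 w1 xw]] := face_sub fF Fx.
  have wF i : w i != 0 -> F (v i).
    by rewrite xw in Fx; exact: (face_weights fF w0 w1).1 Fx i.
  have [i wi] := some_weight_neq0 w1; exists i.
  have : [set x] (v i) by rewrite xE; split; [exact: wF|];
    apply: (wmean_max w0 w1 (g := fun i => dot a (v i)) (b := b)) wi => [j wj|];
    [exact/Fab/wF | by rewrite -axb xw dot_sumr; apply: eq_bigr => j _; rewrite dotZr].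
  by move=> /= ->.
have [a [t [ti tj]]] := vP i.
have le j : dot a (v j) <= dot a (v i).
  by have [->//|/tj lt] := eqVneq j i; apply/ltW/(lt_trans lt).
exists a, (dot a (v i)); split.
  by move=> y /(face_sub fF); exact: hull_dot_le.
apply/seteqP; split => y; first by move=> /= ->; rewrite xE in Fx *.
move=> [/(face_sub fF)[w [w0 w1 yE]] /= e].
have wn j : w j != 0 -> j = i.
  move=> wj; apply/eqP; apply: contraT => ji; have := tj j ji.
  rewrite (wmean_max w0 w1 (g := fun j => dot a (v j)) (fun j _ => le j) _ wj).
    by move=> lt; have := lt_trans ti lt; rewrite ltxx.
  by rewrite -e yE dot_sumr; apply: eq_bigr => k _; rewrite dotZr.
have wz j : j != i -> w j = 0 by move=> ji; apply/eqP; apply: contraNT ji => /wn ->.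
move: w1; rewrite (bigD1 i) //= big1 ?addr0 // => wi.
by rewrite yE xE (bigD1 i) //= big1 ?addr0 ?wi ?scale1r // => j /wz->; rewrite scale0r.
Qed.

Lemma polytope_vertexP x : vertex (face P) x <-> exists i, x = v i.
Proof.
rewrite (face_vertexP _ (face_refl P)); split => [[]//|[i ->]].
by split; [exact: hull_gen | exists i].
Qed.

End Vertices.

(** * The cone of a simple polytope at a vertex *)

Section Corner.
Context {R : realType} {n : nat}.
Implicit Types (x y z a : 'rV[R]_n) (P F : set 'rV[R]_n).

(** The rows of E are edge vectors at x, and P lies in the cone that they span.
    The rows of G, dual to those of E, give the coordinates in this cone; they are
    taken in the span of E so that they can serve as points of the dual
    polytope. *)
Record corner P x d (E G : 'M[R]_(d, n)) : Prop := Corner {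
  corner_dual : E *m G^T = 1%:M;
  corner_sub : (G <= E)%MS;
  corner_apex : P x;
  corner_edge : forall k, P (x + row k E);
  corner_span : forall y, P y -> (y - x <= E)%MS;
  corner_cone : forall y, P y -> forall k, 0 <= dot (y - x) (row k G)
}.

(** The Gram matrix of linearly independent vectors is invertible. *)
Lemma dual_basis d (E : 'M[R]_(d, n)) : row_free E ->
  exists2 G : 'M[R]_(d, n), E *m G^T = 1%:M & (G <= E)%MS.
Proof.
move=> Efree; exists (invmx (E *m E^T) *m E); last exact: submxMl.
rewrite trmx_mul mulmxA trmx_inv trmx_mul trmxK mulmxV //.
rewrite -row_free_unit; apply: inj_row_free => r rE; apply/eqP.
rewrite -(mulmx_free_eq0 _ Efree); apply/eqP/dot_eq0.
by rewrite /dot trmx_mul mulmxA -(mulmxA r) rE mul0mx mxE.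
Qed.

Lemma dual_dot d (E G : 'M[R]_(d, n)) : E *m G^T = 1%:M ->
  forall k l, dot (row k E) (row l G) = (k == l)%:R.
Proof.
move=> EG k l; have := congr1 (fun M : 'M[R]_d => M k l) EG; rewrite !mxE => <-.
by rewrite dotE; apply: eq_bigr => i _; rewrite !mxE.
Qed.

Lemma pyramid_free k x (q : 'I_k -> 'rV[R]_n) a (t : R) :
  affinely_independent q -> (forall i, dot a (q i) = t) -> t < dot a x ->
  row_free (\matrix_i (q i - x)).
Proof.
move=> qI qt tx; apply: inj_row_free => r; rewrite mulmx_sum_row => r0.
have rE : \sum_i r 0 i *: (q i - x) = 0.
  by rewrite -[RHS]r0; apply: eq_bigr => i _; rewrite rowK.
have s0 : \sum_i r 0 i = 0.
  have := congr1 (dot a) rE; rewrite dot_sumr dot0r.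
  under eq_bigr do rewrite dotZr dotBr qt.
  rewrite -mulr_suml => /eqP; rewrite mulf_eq0 => /orP[/eqP//|].
  by rewrite subr_eq0 lt_eqF.
apply/rowP => i; rewrite mxE; apply: qI i => //.
by rewrite -[RHS]rE; under [RHS]eq_bigr do rewrite scalerBr; rewrite sumrB -scaler_suml s0 scale0r subr0.
Qed.

(** The edge vectors point from x to the vertices of the simplex in which a
    hyperplane close to x cuts P. *)
Lemma vertex_corner P d x : simple_polytope P -> has_dim P d -> vertex (face P) x ->
  exists E G : 'M[R]_(d, n), corner P x E G.
Proof.
move=> [polyP simP] dimP xP; have [m [v [PE vP]]] := polytope_vertices polyP.
have [i xE] : exists i, x = v i by apply/(polytope_vertexP vP); rewrite -PE.
have [a [t [tx tv]]] := vP i; rewrite -xE in tx.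
have [|k [q [qI QE]]] := simP x xP (P `&` [set y | dot a y = t]).
  exists a, t; split => // y; rewrite PE (polytope_vertexP vP) => -[j ->] nji.
  by apply: tv; apply: contra_notN nji => /eqP->.
have Qq j : P (q j) /\ dot a (q j) = t.
  by suff : (P `&` [set y | dot a y = t]) (q j) by []; rewrite QE; exact: hull_gen.
pose E := \matrix_j (q j - x).
have Efree : row_free E by apply: (pyramid_free (a := a) (t := t)) => // j; have [] := Qq j.
have [G EG GE] := dual_basis Efree.
have Px : P x by rewrite xE PE; exact: hull_gen.
have Pe j : P (x + row j E) by rewrite rowK subrKC; have [] := Qq j.
(* The cone spanned by E at x contains P since it contains its vertices. *)
have cone j : (v j - x <= E)%MS /\ forall l, 0 <= dot (v j - x) (row l G).
  have [->|ji] := eqVneq j i; first by rewrite -xE subrr sub0mx; split => // l; rewrite dot0l.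
  have jx : dot a (v j) < dot a x by exact: lt_trans (tv j ji) tx.
  pose s := (dot a x - t) / (dot a x - dot a (v j)).
  have s_gt0 : 0 < s by rewrite divr_gt0 // subr_gt0.
  have s_le1 : s <= 1.
    by rewrite /s ler_pdivrMr ?subr_gt0 // mul1r lerB // ltW // tv.
  have : convex_hull q (x + s *: (v j - x)).
    rewrite -QE; split.
      rewrite PE; apply: hull_conv2; rewrite ?(ltW s_gt0) //; last exact: hull_gen.
      by rewrite -PE.
    rewrite /= dotDr dotZr dotBr -opprB mulrN /s divfK ?subr_eq0 ?gt_eqF //.
    by rewrite opprB subrKC.
  move=> [w [w0 w1 /(canRL (addKr _))]]; rewrite [- x + _]addrC convex_combB // => sE.
  have -> : v j - x = s^-1 *: \sum_l w l *: row l E.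
    apply: (scalerI (lt0r_neq0 s_gt0)); rewrite scalerA divff ?lt0r_neq0 // scale1r sE.
    by apply: eq_bigr => l _; rewrite rowK.
  split; first by rewrite scalemx_sub // summx_sub // => l _; rewrite scalemx_sub // row_sub.
  move=> l; rewrite dotZl mulr_ge0 ?invr_ge0 ?(ltW s_gt0) // dot_suml.
  apply: sumr_ge0 => j' _; rewrite dotZl mulr_ge0 //.
  by rewrite (dual_dot EG) ler0n.
have span y : P y -> (y - x <= E)%MS.
  rewrite PE => -[w [_ w1 ->]]; rewrite convex_combB //; apply: summx_sub => j _.
  by rewrite scalemx_sub //; have [] := cone j.
have nonneg y : P y -> forall l, 0 <= dot (y - x) (row l G).
  rewrite PE => -[w [w0 w1 ->]] l; rewrite convex_combB // dot_suml; apply: sumr_ge0 => j _.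
  by rewrite dotZl mulr_ge0 //; have [] := cone j.
have kd : k = d.
  exact: has_dim_uniq (has_dim_mx Efree Px Pe span) dimP.
by subst k; exists E, G; split.
Qed.

(** The face of P spanned by the edges at x with index in K *)
Definition corner_face P x d (G : 'M[R]_(d, n)) (K : {set 'I_d}) : set 'rV[R]_n :=
  P `&` [set y | forall k, k \notin K -> dot (y - x) (row k G) = 0].

Section CornerFaces.
Context {P : set 'rV[R]_n} {x : 'rV[R]_n} {d : nat} {E G : 'M[R]_(d, n)}.
Context (cP : corner P x E G).

Lemma corner_dot k l : dot (row k E) (row l G) = (k == l)%:R.
Proof. exact: dual_dot (corner_dual cP) k l. Qed.

Lemma span_coords y : (y <= E)%MS -> y = \sum_k dot y (row k G) *: row k E.
Proof.
move=> /submxP[r ->]; rewrite {1}mulmx_sum_row; apply: eq_bigr => k _.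
rewrite mulmx_sum_row dot_suml (bigD1 k) //= big1 ?addr0 => [|l lk]; rewrite dotZl corner_dot.
  by rewrite eqxx mulr1.
by rewrite (negPf lk) mulr0.
Qed.

Lemma corner_coords y : P y -> y = x + \sum_k dot (y - x) (row k G) *: row k E.
Proof. by move=> Py; rewrite -span_coords ?subrKC //; exact: corner_span cP _ Py. Qed.

(** The coordinates are nonnegative on P, so the sum of those outside K attains its
    minimum 0 exactly where they all vanish. *)
Lemma corner_face_face K : face P (corner_face P x G K).
Proof.
pose a := - \sum_(k | k \notin K) row k G.
have aE y : dot a y = dot a x - \sum_(k | k \notin K) dot (y - x) (row k G).
  rewrite -{1}[y](subrKC x) dotDr [dot a (y - x)]dotC; congr (_ + _).
  by rewrite dotNr dot_sumr.
exists a, (dot a x); split=> [y Py|].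
  by rewrite aE gerBl sumr_ge0 // => k _; exact: corner_cone cP _ Py k.
apply/seteqP; split => y [Py yK]; split => //=.
  by rewrite aE big1 ?subr0 // => k kK; exact: yK.
move=> k kK; apply/eqP; move: yK => /= /eqP; rewrite aE -subr_eq0 addrAC subrr add0r oppr_eq0.
rewrite psumr_eq0 => [/allP/(_ k)|l _]; last exact: corner_cone cP _ Py l.
by rewrite mem_index_enum kK => /(_ isT).
Qed.

Lemma corner_face_apex K : corner_face P x G K x.
Proof. by split; [exact: corner_apex cP | move=> k _; rewrite subrr dot0l]. Qed.

Lemma corner_face_edge K k : corner_face P x G K (x + row k E) <-> k \in K.
Proof.
split=> [[_ /= xK]|kK].
  apply: contraT => kK; have := xK k kK; rewrite addrC addKr corner_dot eqxx.
  by move/eqP; rewrite oner_eq0.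
split=> [|l lK /=]; first exact: corner_edge cP k.
by rewrite addrC addKr corner_dot; case: eqP kK lK => [->|//] ->.
Qed.

Lemma corner_face_dim K : has_dim (corner_face P x G K) #|K|.
Proof.
pose EK : 'M[R]_(#|K|, n) := \matrix_i row (enum_val i) E.
apply: (@has_dim_mx _ _ _ x _ EK).
- apply/row_freeP; exists (\matrix_i row (enum_val i) G)^T; apply/matrixP => i j.
  rewrite !mxE -(inj_eq enum_val_inj) -corner_dot dotE.
  by apply: eq_bigr => l _; rewrite !mxE.
- exact: corner_face_apex.
- by move=> i; rewrite rowK; apply/corner_face_edge/enum_valP.
move=> y [Py yK]; rewrite (span_coords (corner_span cP Py)).
apply: summx_sub => k _; have [kK|/yK->] := boolP (k \in K); last by rewrite scale0r sub0mx.
by rewrite scalemx_sub // (eq_row_sub (enum_rank_in kK k)) // rowK enum_rankK_in.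
Qed.

(** A functional that is maximal at x is nonpositive on all edge vectors, and its
    face is spanned by those on which it vanishes. *)
Lemma face_corner_face F : face P F -> F x ->
  exists K, F = corner_face P x G K.
Proof.
move=> [a [b [Pab ->]]] [_ /= axb]; exists [set k | dot a (row k E) == 0]%SET.
have le k : dot a (row k E) <= 0.
  by have := Pab _ (corner_edge cP k); rewrite dotDr axb gerDl.
have aE y : P y -> dot a y = b + \sum_k dot (y - x) (row k G) * dot a (row k E).
  move=> Py; rewrite {1}(corner_coords Py) dotDr axb dot_sumr; congr (_ + _).
  by apply: eq_bigr => k _; rewrite dotZr.
apply/seteqP; split => y [Py /= yb]; split => //=.
  move=> k; rewrite inE => ak.
  have : \sum_k - (dot (y - x) (row k G) * dot a (row k E)) == 0.
    by rewrite sumrN oppr_eq0; apply/eqP/(addrI b); rewrite addr0 -aE.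
  rewrite psumr_eq0 => [/allP/(_ k)|l _]; last first.
    by rewrite -mulrN mulr_ge0 ?oppr_ge0 //; exact: corner_cone cP _ Py l.
  by rewrite mem_index_enum oppr_eq0 mulf_eq0 (negPf ak) orbF => /(_ isT)/eqP.
rewrite aE // big1 ?addr0 // => k _.
have [->|ak] := eqVneq (dot a (row k E)) 0; first by rewrite mulr0.
by rewrite yb ?mul0r // inE.
Qed.

End CornerFaces.
End Corner.

(** * The incidence structure of a simple polytope *)

Section FacetIncidence.
Context {R : realType} {n m d : nat} (v : 'I_m -> 'rV[R]_n).
Implicit Types (F : set 'rV[R]_n) (i j : 'I_m) (S : {set 'I_m}).
Let P := convex_hull v.

Definition vertex_set F : {set 'I_m} := [set i | `[< F (v i) >]]%SET.

Definition facet_family : {set {set 'I_m}} :=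
  [set S | `[< exists2 F, facet P F & S = vertex_set F >]]%SET.

Lemma in_vertex_set F i : (i \in vertex_set F) <-> F (v i).
Proof. by rewrite inE; split => /asboolP. Qed.

Lemma vertex_set_inj F F' : face P F -> face P F' -> vertex_set F = vertex_set F' -> F = F'.
Proof.
move=> fF fF' e; apply/seteqP; split.
  by apply: (face_subset fF fF') => i /in_vertex_set; rewrite e => /in_vertex_set.
by apply: (face_subset fF' fF) => i /in_vertex_set; rewrite -e => /in_vertex_set.
Qed.

Lemma facet_familyP S : reflect (exists2 F, facet P F & S = vertex_set F) (S \in facet_family).
Proof. by rewrite inE; apply: asboolP. Qed.

Context (vP : strictly_exposed v) (simP : simple_polytope P) (dimP : has_dim P d).
Context (d_gt0 : (0 < d)%N).

Section AtCorner.
Context (i : 'I_m) (E G : 'M[R]_(d, n)) (cP : corner P (v i) E G).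

(* The coordinate of the vertex v j along the edge k of the cone at v i *)
Local Notation slack k j := (dot (v j - v i) (row k G)).

(** The facet at v i opposite to the edge k *)
Definition corner_facet k := vertex_set (corner_face P (v i) G (~: [set k])%SET).

Lemma slack_ge0 k j : 0 <= slack k j.
Proof. by apply: (corner_cone cP); exact: hull_gen. Qed.

Lemma in_corner_face (K : {set 'I_d}) j :
  (j \in vertex_set (corner_face P (v i) G K)) = [forall k, (k \notin K) ==> (slack k j == 0)].
Proof.
apply/idP/forallP => [/in_vertex_set[_ jK] k|jK]; first by apply/implyP => /jK/eqP.
apply/in_vertex_set; split; first exact: hull_gen.
by move=> k kK; apply/eqP/(implyP (jK k)).
Qed.

Lemma in_corner_facet k j : (j \in corner_facet k) = (slack k j == 0).
Proof.
rewrite in_corner_face; apply/forallP/eqP => [/(_ k)|jk l].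
  by rewrite !inE eqxx => /eqP.
by apply/implyP; rewrite !inE negbK => /eqP ->; rewrite jk.
Qed.

Lemma facet_corner_face k : facet P (corner_face P (v i) G (~: [set k])%SET).
Proof.
split; first exact: corner_face_face cP _.
exists d.-1; rewrite prednK //; split => //.
have -> : d.-1 = #|(~: [set k])%SET| by rewrite cardsC1 card_ord.
exact: (corner_face_dim cP).
Qed.

Lemma facet_at_corner F : facet P F -> F (v i) ->
  exists k, F = corner_face P (v i) G (~: [set k])%SET.
Proof.
move=> [fF [k [Pk Fk]]] Fi; have [K FK] := face_corner_face cP fF Fi; rewrite FK in Fk *.
have cK : #|K| = k := has_dim_uniq (corner_face_dim cP K) Fk.
have /cards1P[l Kl] : #|~: K|%SET == 1%N.
  by rewrite cardsCs finset.setCK card_ord cK (has_dim_uniq dimP Pk) subSnn.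
by exists l; rewrite -Kl finset.setCK.
Qed.

Lemma facets_at_corner : facets_at facet_family i = (corner_facet @: [set: 'I_d])%SET.
Proof.
apply/setP => S; rewrite mem_facets_at; apply/andP/imsetP => [[]|[k _ ->]].
  move=> /facet_familyP[F fF ->] /in_vertex_set Fi.
  by have [k ->] := facet_at_corner fF Fi; exists k.
split; last by rewrite in_corner_facet subrr dot0l.
by apply/facet_familyP; eexists; [exact: facet_corner_face|].
Qed.

(** The point v i + e_k lies on an edge and is a convex combination of vertices,
    which all belong to that edge; one of them differs from v i. *)
Lemma edge_neighbor k : exists j, 0 < slack k j /\ forall l, l != k -> slack l j = 0.
Proof.
have fE := corner_face_face cP [set k]%SET.
have := (corner_face_edge cP [set k]%SET k).2 (set11 k).
set x := v i + row k E => xE; have [w [w0 w1 xw]] := face_sub fE xE.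
have wE j : w j != 0 -> corner_face P (v i) G [set k]%SET (v j).
  by rewrite xw in xE; exact: (face_weights fE w0 w1).1 xE j.
have : \sum_j w j * slack k j = 1.
  rewrite -[RHS](_ : dot (x - v i) (row k G) = 1) ?xw; last first.
    by rewrite -xw addrC addKr (corner_dot cP) eqxx.
  by rewrite convex_combB // dot_suml; apply: eq_bigr => j _; rewrite dotZl.
have [/existsP[j /andP[wj sj]] _|none] := boolP [exists j, (w j != 0) && (slack k j != 0)].
  exists j; split => [|l lk]; first by rewrite lt_def sj slack_ge0.
  by have [_] := wE j wj; apply; rewrite inE.
rewrite big1 => [/eqP|j _]; first by rewrite eq_sym oner_eq0.
move: none; rewrite negb_exists => /forallP/(_ j); rewrite negb_and !negbK.
by case/orP => /eqP->; rewrite ?mul0r ?mulr0.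
Qed.

Lemma corner_facet_inj : injective corner_facet.
Proof.
move=> k l e; apply/eqP; apply: contraT => kl; have [j [sj j0]] := edge_neighbor k.
have : j \in corner_facet k by rewrite e in_corner_facet j0 // eq_sym.
by rewrite in_corner_facet gt_eqF.
Qed.

Lemma common_corner_facets K :
  common facet_family (corner_facet @: ~: K)%SET = vertex_set (corner_face P (v i) G K).
Proof.
apply/setP => j; rewrite mem_common in_corner_face; apply/fintype.subsetP/forallP => jK.
  move=> k; apply/implyP => kK; rewrite -in_corner_facet.
  have := jK (corner_facet k); rewrite mem_facets_at => /(_ _)/andP[]//.
  by apply: imset_f; rewrite inE.
move=> _ /imsetP[k kK ->]; rewrite mem_facets_at in_corner_facet.
rewrite inE in kK; rewrite (implyP (jK k)) // andbT.
by apply/facet_familyP; eexists; [exact: facet_corner_face|].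
Qed.

Lemma corner_facetsD1 (K : {set 'I_d}) k :
  ((corner_facet @: ~: K) :\ corner_facet k = corner_facet @: ~: (k |: K))%SET.
Proof.
apply/setP => S; rewrite in_setD1; apply/andP/imsetP.
  move=> [Sk /imsetP[l lK Sl]]; exists l => //; rewrite !inE negb_or.
  by rewrite inE in lK; rewrite lK andbT; apply: contraNneq Sk => <-; apply/eqP.
move=> [l]; rewrite !inE negb_or => /andP[lk lK] ->.
by rewrite (inj_eq corner_facet_inj) lk imset_f // inE.
Qed.

Lemma facets_at_corner0 : facets_at facet_family i = (corner_facet @: ~: finset.set0)%SET.
Proof. by rewrite facets_at_corner finset.setC0. Qed.

(** There is room for only two vertices on a line. *)
Lemma edge_vertices k j : 0 < slack k j -> (forall l, l != k -> slack l j = 0) ->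
  vertex_set (corner_face P (v i) G [set k]%SET) = [set i; j]%SET.
Proof.
move=> sj j0; have vE u : (forall l, l != k -> slack l u = 0) -> v u = v i + slack k u *: row k E.
  move=> u0; rewrite {1}(corner_coords cP (hull_gen v u)) (bigD1 k) //= big1 ?addr0 // => l lk.
  by rewrite [dot _ _]u0 // scale0r.
(* Of three vertices on a line, the middle one is not exposed. *)
have between u w : (forall l, l != k -> slack l u = 0) -> (forall l, l != k -> slack l w = 0) ->
    0 < slack k u -> slack k u < slack k w -> False.
  move=> u0 w0 su uw; have [a [t [tu ta]]] := vP u.
  have nui : i != u by apply: contraTneq su => <-; rewrite subrr dot0l ltxx.
  have nuw : w != u by apply: contraTneq uw => ->; rewrite ltxx.
  have := ta i nui; have := ta w nuw; have := tu.
  rewrite (vE u u0) (vE w w0) !dotDr !dotZr.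
  set p := dot a (v i); set q := dot a _; move: su uw; set s := slack k u; set s' := slack k w.
  move=> s0 ss' h1 h2 h3.
  have : s * (p + s' * q) < s * t by rewrite ltr_pM2l.
  have : (s' - s) * p < (s' - s) * t by rewrite ltr_pM2l // subr_gt0.
  have : s' * t < s' * (p + s * q) by rewrite ltr_pM2l // (lt_trans s0).
  lra.
apply/setP => u; rewrite in_corner_face !inE; apply/forallP/orP => [u0|].
  have {}u0 l : l != k -> slack l u = 0.
    by move=> lk; apply/eqP/(implyP (u0 l)); rewrite inE.
  have [su0|su] := eqVneq (slack k u) 0.
    by left; apply/eqP/(strictly_exposed_inj vP); rewrite vE // su0 scale0r addr0.
  have {}su : 0 < slack k u by rewrite lt_def su slack_ge0.
  right; apply/eqP/(strictly_exposed_inj vP); rewrite vE // (vE j) //.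
  case: (ltgtP (slack k u) (slack k j)) => [lt|lt|->//]; first by case: (between u j).
  by case: (between j u).
by case=> /eqP-> l; apply/implyP; rewrite inE => lk; rewrite ?j0 // subrr dot0l.
Qed.

End AtCorner.
End FacetIncidence.

(** Take a = (1, t, t^2, ...): for each pair of points, a fails to separate them
    only if t is a root of a certain nonzero polynomial. *)
Lemma generic_functional (R : realType) (n m : nat) (v : 'I_m -> 'rV[R]_n) :
  injective v -> exists a, injective (fun i => dot a (v i)).
Proof.
move=> v_inj.
pose p : {poly R} := \prod_(ij : 'I_m * 'I_m | ij.1 != ij.2) rVpoly (v ij.1 - v ij.2).
have p0 : p != 0.
  apply/prodf_neq0 => -[i j] /= ij; apply: contraNneq ij => e.
  apply/eqP/v_inj/eqP; rewrite -subr_eq0 -[v i - v j]rVpolyK e; apply/eqP.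
  by apply/rowP => k; rewrite !mxE coef0.
have [/(max_poly_roots p0)|/allPn[_ /mapP[t _ ->] nroot]] :=
    boolP (all (root p) (map (GRing.natmul 1) (iota 0 (size p)))).
  rewrite size_map size_iota ltnn map_inj_uniq ?iota_uniq; first by move=> /(_ isT).
  by move=> s t /eqP; rewrite eqr_nat => /eqP.
exists (\row_k t%:R ^+ k) => i j /eqP; rewrite -subr_eq0 -dotBr => /eqP e.
apply/eqP; apply: contraNT nroot => ij.
rewrite /root horner_prod; apply/prodf_eq0; exists (i, j) => //=.
rewrite (@horner_coef_wide _ n) ?size_poly // -[X in _ == X]e dotC dotE; apply/eqP.
by apply: eq_bigr => k _; rewrite coef_rVpoly_ord !mxE.
Qed.
Section Translation.
Context {R : realType} {n m d : nat} {v : 'I_m -> 'rV[R]_n}.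
Implicit Types (F : set 'rV[R]_n) (i j : 'I_m) (S : {set 'I_m}).
Let P := convex_hull v.
Let FS := facet_family v.
Context (vP : strictly_exposed v) (simP : simple_polytope P) (dimP : has_dim P d).
Context (d_gt0 : (0 < d)%N).

Lemma corner_at i : exists E G : 'M[R]_(d, n), corner P (v i) E G.
Proof. by apply: (vertex_corner simP dimP); apply/(polytope_vertexP vP); exists i. Qed.

Lemma some_corner : exists i (E G : 'M[R]_(d, n)), corner P (v i) E G.
Proof.
have [x Px] := has_dim_nonempty dimP; have [i _] := face_has_vertex (face_refl P) Px.
by exists i; exact: corner_at.
Qed.

Section AtCorner.
Context {i : 'I_m} {E G : 'M[R]_(d, n)} (cP : corner P (v i) E G).
Let cf := corner_facet v i G.

Lemma facets_at_cornerD1 k : (facets_at FS i :\ cf k = cf @: ~: [set k])%SET.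
Proof.
by rewrite (facets_at_corner0 dimP d_gt0 cP) (corner_facetsD1 cP) finset.setU0.
Qed.

Lemma common_edge k : common FS (facets_at FS i :\ cf k)%SET =
  vertex_set v (corner_face P (v i) G [set k]%SET).
Proof. by rewrite facets_at_cornerD1 (common_corner_facets dimP d_gt0 cP). Qed.

Lemma common_2face k l : common FS (facets_at FS i :\ cf k :\ cf l)%SET =
  vertex_set v (corner_face P (v i) G [set l; k]%SET).
Proof. by rewrite facets_at_cornerD1 (corner_facetsD1 cP) (common_corner_facets dimP d_gt0 cP). Qed.

Lemma in_facets_at S : S \in facets_at FS i -> exists k, S = cf k.
Proof. by rewrite (facets_at_corner dimP d_gt0 cP) => /imsetP[k _ ->]; exists k. Qed.

Lemma corner_facet_at k : cf k \in facets_at FS i.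
Proof. by rewrite (facets_at_corner dimP d_gt0 cP) imset_f ?inE. Qed.

End AtCorner.

(** The facets at v i correspond to the d edges of the cone at v i. *)
Lemma facet_incidence : simple_incidence FS d.
Proof.
split=> [i|i F]; have [E [G cP]] := corner_at i.
  rewrite (facets_at_corner dimP d_gt0 cP) card_imset ?cardsT ?card_ord //.
  exact: corner_facet_inj cP.
move=> /(in_facets_at cP)[k ->]; have [j [sj j0]] := edge_neighbor cP k.
exists j; rewrite (common_edge cP) (edge_vertices vP cP sj j0) in_corner_facet.
by rewrite gt_eqF.
Qed.

(** In the cone at v i, a vertex of the face is reached by a nonnegative combination
    of edge vectors of the face, and these are positive multiples of the vectors
    towards the neighbors of v i. *)
Lemma linear_local_min a : local_min_global FS (fun i => dot a (v i)).
Proof.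
move=> i B Bi loc u uB; have [E [G cP]] := corner_at i.
rewrite (corner_coords cP (hull_gen v u)) dotDr lerDl dot_sumr.
apply: sumr_ge0 => k _; rewrite dotZr.
have [->|su] := eqVneq (dot (v u - v i) (row k G)) 0; first by rewrite mul0r.
rewrite mulr_ge0 ?(slack_ge0 cP) //.
have kB : corner_facet v i G k \notin B.
  apply: contraNN su => kB; rewrite -in_corner_facet.
  by move: uB; rewrite mem_common => /fintype.subsetP/(_ _ kB); rewrite mem_facets_at => /andP[].
have [j [sj j0]] := edge_neighbor cP k.
have jE : common FS (facets_at FS i :\ corner_facet v i G k)%SET = [set i; j]%SET.
  by rewrite (common_edge cP) (edge_vertices vP cP sj j0).
have jk : j \in common FS (facets_at FS i :\ corner_facet v i G k)%SET.
  by rewrite jE !inE eqxx orbT.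
have ij : adjacent FS i j.
  apply/andP; split; first by apply: contraTneq sj => <-; rewrite subrr dot0l ltxx.
  by apply/existsP; exists (corner_facet v i G k); rewrite (corner_facet_at cP).
have jB : j \in common FS B.
  move: jk; rewrite !mem_common; apply: fintype.subset_trans; apply/fintype.subsetP => F FB.
  rewrite in_setD1 (fintype.subsetP Bi) // andbT; by apply: contraNneq kB => <-.
have := loc j ij jB; rewrite (corner_coords cP (hull_gen v j)) dotDr lerDl dot_sumr.
rewrite (bigD1 k) //= big1 ?addr0 => [|l lk]; last by rewrite j0 // scale0r dot0r.
by rewrite dotZr pmulr_rge0.
Qed.

Lemma face_vertices_card F : face P F -> vertex (face F) #= `I_#|vertex_set v F|.
Proof.
move=> fF; rewrite (card_eqr card_II).
have -> : vertex (face F) =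
    (fun k : 'I_#|vertex_set v F| => v (enum_val k)) @` [set: 'I_#|vertex_set v F|].
  apply/seteqP; split => x.
    move=> /(face_vertexP vP _ fF)[Fx [i xi]]; rewrite xi in Fx *.
    have iF : i \in vertex_set v F by apply/in_vertex_set.
    by exists (enum_rank_in iF i) => //; rewrite enum_rankK_in.
  move=> [k _ <-]; apply/(face_vertexP vP _ fF); split; last by eexists.
  exact: (in_vertex_set v F (enum_val k)).1 (enum_valP k).
by apply: inj_card_eq => k l _ _ /(strictly_exposed_inj vP)/enum_val_inj.
Qed.

(** By the dimensions, the 2-faces at a vertex are those spanned by two edges of
    its cone. *)
Lemma even_polytopeP : even_polytope P <-> even_2faces FS.
Proof.
split=> [evP i F F' Fi F'i|ev F fF dF].
  have [E [G cP]] := corner_at i.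
  have [k ->] := in_facets_at cP Fi; have [l ->] := in_facets_at cP F'i.
  rewrite (inj_eq (corner_facet_inj cP)) (common_2face cP) => kl.
  have fK := corner_face_face cP [set l; k]%SET.
  have [|e me] := evP _ fK.
    by have := corner_face_dim cP [set l; k]%SET; rewrite cards2 eq_sym kl.
  have /card_eq_II-> := card_eq_trans (card_esym (face_vertices_card fK)) me.
  by rewrite odd_double.
have [x Fx] := has_dim_nonempty dF.
have [i Fi] := face_has_vertex fF Fx; have [E [G cP]] := corner_at i.
have [K FK] := face_corner_face cP fF Fi.
have K2 : #|K| = 2.
  by rewrite FK in dF; exact: has_dim_uniq (corner_face_dim cP K) dF.
have /cards2P[k [l [kl KE]]] := introT eqP K2.
have := ev _ _ _ (corner_facet_at cP l) (corner_facet_at cP k).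
rewrite (common_2face cP) (inj_eq (corner_facet_inj cP)) eq_sym kl -KE -FK => /(_ isT) evF.
exists #|vertex_set v F|./2; rewrite even_halfK //; exact: face_vertices_card.
Qed.

Lemma joined_adjacent i j : joined_by_edge (face P) (v i) (v j) <-> adjacent FS i j.
Proof.
have [E [G cP]] := corner_at i; split.
  move=> [nij [e [fe de ei ej]]]; apply/andP; split; first by apply: contra_not_neq nij => ->.
  have [K eK] := face_corner_face cP fe ei.
  have K1 : #|K| == 1%N.
    by rewrite eK in de; rewrite (has_dim_uniq (corner_face_dim cP K) de).
  have /cards1P[k KE] := K1; apply/existsP; exists (corner_facet v i G k).
  rewrite (corner_facet_at cP) (common_edge cP) -KE -eK; exact/in_vertex_set.
move=> /andP[ij /existsP[F /andP[/(in_facets_at cP)[k ->]]]].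
rewrite (common_edge cP) => /in_vertex_set jk; split.
  by move/(strictly_exposed_inj vP)/eqP; rewrite (negPf ij).
exists (corner_face P (v i) G [set k]%SET); split => //.
- exact: corner_face_face cP _.
- by have := corner_face_dim cP [set k]%SET; rewrite cards1.
- exact: corner_face_apex cP _.
Qed.

Lemma bipartite_polytopeP :
  bipartite (vertex (face P)) (joined_by_edge (face P)) <->
  exists col, bipartite_on FS [set: 'I_m]%SET col.
Proof.
split=> [[c cP]|[col bip]].
  exists (c \o v) => i j _ _ /joined_adjacent ij; apply/eqP/cP => //.
    by apply/(polytope_vertexP vP); exists i.
  by apply/(polytope_vertexP vP); exists j.
exists (fun x => `[< exists2 i, x = v i & col i >]) => x y.
move=> /(polytope_vertexP vP)[i ->] /(polytope_vertexP vP)[j ->] /joined_adjacent ij.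
have colE u : `[< exists2 i, v u = v i & col i >] = col u.
  by apply/asboolP/idP => [[w /(strictly_exposed_inj vP)->]//|cu]; exists u.
by rewrite !colE; apply/eqP/bip.
Qed.

(** Two facets that meet have a vertex in common. *)
Lemma colorable_facetsP k :
  colorable (facet P) (fun F F' => F <> F' /\ F `&` F' !=set0) k <->
  exists c, colored_on FS k [set: 'I_m]%SET c.
Proof.
split=> [[c [c_lt cP]]|[c cP]].
  pose g S := xget set0 [set F | facet P F /\ vertex_set v F = S].
  have gE F : facet P F -> g (vertex_set v F) = F.
    move=> fF; apply: xget_unique => // F' [fF' e].
    exact: vertex_set_inj fF'.1 fF.1 e.
  exists (c \o g) => i _; split => [_ /setIdP[/facet_familyP[F fF ->] _]|].
    by rewrite /= gE // c_lt.
  move=> _ _ /setIdP[/facet_familyP[F fF ->] iF] /setIdP[/facet_familyP[F' fF' ->] iF'].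
  rewrite /= !gE // => e; congr vertex_set; apply/eqP; apply/contraT => /eqP FF'.
  exfalso; apply: (cP F F') => //; split => //.
  by exists (v i); split; [exact: (in_vertex_set v F i).1 | exact: (in_vertex_set v F' i).1].
exists (c \o vertex_set v); have fam F : facet P F -> vertex_set v F \in FS.
  by move=> fF; apply/facet_familyP; exists F.
have at_v F i : facet P F -> F (v i) -> vertex_set v F \in facets_at FS i.
  by move=> /fam fF Fi; rewrite mem_facets_at fF; apply/in_vertex_set.
split=> [F fF|F F' fF fF' [FF' /(meeting_faces fF.1 fF'.1)[i [Fi F'i]]]].
  have [_ [k' [_ /has_dim_nonempty[x Fx]]]] := fF.
  have [i Fi] := face_has_vertex fF.1 Fx.
  by apply: (cP i _).1 => //; exact: at_v.
move=> /= e; apply: FF'; apply: (vertex_set_inj fF.1 fF'.1).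
by apply: (cP i _).2 => //; exact: at_v.
Qed.

Lemma colorable_ge k : colorable (facet P) (fun F F' => F <> F' /\ F `&` F' !=set0) k ->
  (d <= k)%N.
Proof.
move=> /colorable_facetsP[c cP].
have [i _] := some_corner.
have [c_lt c_inj] := cP i (finset.in_setT i).
rewrite -(card_facets_at facet_incidence i) cardE -(size_map c) -(size_iota 0 k).
apply: uniq_leq_size.
  by rewrite map_inj_in_uniq ?enum_uniq // => F F'; rewrite !mem_enum; exact: c_inj.
by move=> b /mapP[F]; rewrite mem_enum => /c_lt lt ->; rewrite mem_iota.
Qed.

Lemma gammaP : gamma P = d <-> exists c, colored_on FS d [set: 'I_m]%SET c.
Proof.
rewrite -colorable_facetsP /gamma /chromatic_number; split => [|col].
  case: xgetP => [k kE [colk _] kd|_ d0]; first by rewrite -kd.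
  by move: d_gt0; rewrite -d0.
apply: xget_unique; first by split => // k; exact: colorable_ge.
move=> k [colk kmin]; apply/eqP; rewrite eqn_leq colorable_ge // andbT.
exact: kmin.
Qed.

End Translation.

(** * The dual polytope *)

Lemma submx_diff (K : fieldType) r s t (A B : 'M[K]_(r, t)) (C : 'M[K]_(s, t)) :
  (A <= C)%MS -> (B <= C)%MS -> (A - B <= C)%MS.
Proof. by move=> AC BC; rewrite addmx_sub // eqmx_opp. Qed.

Section DualCorner.
Context {R : realType} {n m d : nat} (v : 'I_m -> 'rV[R]_n) (z : 'rV[R]_n).
Implicit Types (x y a c : 'rV[R]_n) (F : set 'rV[R]_n) (i j : 'I_m).
Let P := convex_hull v.
Let D := dual_polytope P z.
Context (zP : relative_interior P z).

Section AtCorner.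
Context (x : 'rV[R]_n) (E G : 'M[R]_(d, n)) (cP : corner P x E G).
Implicit Types (k l : 'I_d) (K : {set 'I_d}).

Lemma relative_interior_mem : P z.
Proof. by case: zP. Qed.

Lemma corner_diff p q : P p -> P q -> (p - q <= E)%MS.
Proof.
move=> /(corner_span cP) pE /(corner_span cP) qE.
have -> : p - q = (p - x) - (q - x) by rewrite opprB addrA subrK.
exact: submx_diff.
Qed.

(** The linear space parallel to the affine hull of P is spanned by the edges at
    any vertex. *)
Lemma dual_polytopeP y : D y <-> (y <= E)%MS /\ forall p, P p -> dot (p - z) y <= 1.
Proof.
rewrite /D /dual_polytope /= (affine_hull_mx (corner_apex cP) (corner_edge cP) (corner_span cP)) /=.
suff -> : (z + y - x <= E)%MS = (y <= E)%MS by [].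
have zE := corner_diff relative_interior_mem (corner_apex cP).
rewrite addrAC; apply/idP/idP => yE; last exact: addmx_sub.
by rewrite -(addrK (z - x) y) [y + _]addrC submx_diff.
Qed.

Lemma dual_polytope_hull y : (y <= E)%MS -> (forall i, dot (v i - z) y <= 1) -> D y.
Proof.
move=> yE yv; apply/dual_polytopeP; split => // p Pp.
rewrite dotBl lerBlDr (dotC p); apply: hull_dot_le Pp => i.
by rewrite dotC -lerBlDr -dotBl.
Qed.

Lemma dual0 : D 0.
Proof. by apply/dual_polytopeP; split => [|p _]; rewrite ?sub0mx // dot0r ler01. Qed.

Lemma span_ortho y : (y <= E)%MS -> (forall k, dot (row k E) y = 0) -> y = 0.
Proof.
move=> yE y0; apply: dot_eq0; rewrite {1}(span_coords cP yE) dot_suml big1 // => k _.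
by rewrite dotZl y0 mulr0.
Qed.

Lemma span_project a : exists2 a', (a' <= E)%MS & forall y, (y <= E)%MS -> dot a y = dot a' y.
Proof.
exists (\sum_k dot a (row k E) *: row k G).
  by apply: summx_sub => k _; rewrite scalemx_sub // (submx_trans (row_sub _ _) (corner_sub cP)).
move=> y yE; rewrite {1}(span_coords cP yE) dot_sumr dot_suml; apply: eq_bigr => k _.
by rewrite dotZr dotZl mulrC (dotC y).
Qed.

(** From a relative interior point one can move a little in the direction - e_k and
    stay in P, where the coordinate is nonnegative; so it was positive before. *)
Lemma interior_slack k : 0 < dot (z - x) (row k G).
Proof.
have [_ zn] := zP.
have : (fun e : R => z - e *: row k E) @ (0 : R) --> z.
  rewrite -[X in _ --> X]subr0 -[in X in _ --> X](scale0r (row k E)).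
  apply: cvgB; first exact: cvg_cst.
  by apply: cvgZr_tmp; exact: cvg_id.
move=> /(_ _ zn); rewrite nbhs_simpl /= => /nbhs_ballP[r /= r_gt0 rP].
have e_gt0 : 0 < r / 2 by rewrite divr_gt0.
have : P (z - (r / 2) *: row k E).
  apply: rP.
    by rewrite /ball /= sub0r normrN gtr0_norm // gtr_pMr // invf_lt1 // ltr1n.
  rewrite (affine_hull_mx (corner_apex cP) (corner_edge cP) (corner_span cP)) /= addrAC.
  apply: submx_diff; first exact: corner_diff relative_interior_mem (corner_apex cP).
  by rewrite scalemx_sub ?row_sub.
move=> /(corner_cone cP)/(_ k); rewrite addrAC (dotBl (z - x)) dotZl (corner_dot cP) eqxx mulr1 subr_ge0.
exact: lt_le_trans.
Qed.

(** The vectors x - z and e_l for l <> k span the same space as all the e_l, because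
    the coordinate of z along e_k is nonzero. *)
Lemma dual_uniq k y y' : (y <= E)%MS -> (y' <= E)%MS -> dot (x - z) y = dot (x - z) y' ->
  (forall l, l != k -> dot (row l E) y = dot (row l E) y') -> y = y'.
Proof.
move=> yE y'E e0 e; apply/eqP; rewrite -subr_eq0; apply/eqP/span_ortho.
  exact: submx_diff.
move=> l; rewrite dotBr; have [->|/e->] := eqVneq l k; last by rewrite subrr.
have /eqP := e0; rewrite -[x - z]opprB !dotNl eqr_opp -subr_eq0 -(dotBr y y' (z - x)).
rewrite {1}(span_coords cP (corner_diff relative_interior_mem (corner_apex cP))) dot_suml (bigD1 k) //= big1; last first.
  by move=> j jk; rewrite dotZl (dotBr y) e // subrr mulr0.
by rewrite addr0 dotZl mulf_eq0 gt_eqF ?interior_slack //= (dotBr y) => /eqP.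
Qed.

(** The vertex of the dual polytope that corresponds to the facet opposite to e_k:
    it is normal to that facet, with the length for which <p - z, y> = 1 there. *)
Definition dual_vertex k := - (dot (z - x) (row k G))^-1 *: row k G.

Lemma dual_vertex_sub k : (dual_vertex k <= E)%MS.
Proof. by rewrite scalemx_sub // (submx_trans (row_sub _ _) (corner_sub cP)). Qed.

Lemma dot_dual_vertex p k :
  dot (p - z) (dual_vertex k) = 1 - dot (p - x) (row k G) / dot (z - x) (row k G).
Proof.
have -> : p - z = (p - x) - (z - x) by rewrite opprB addrA subrK.
rewrite dotZr (dotBl (p - x)) mulrBr !mulNr opprK addrC.
by rewrite mulVf ?gt_eqF ?interior_slack // [_^-1 * _]mulrC.
Qed.

Lemma edge_dual_vertex k l :
  dot (row l E) (dual_vertex k) = - (dot (z - x) (row k G))^-1 * (l == k)%:R.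
Proof. by rewrite dotZr (corner_dot cP). Qed.

Lemma dual_vertex_in k : D (dual_vertex k).
Proof.
apply/dual_polytopeP; split => [|p Pp]; first exact: dual_vertex_sub.
rewrite dot_dual_vertex gerBl.
by apply: divr_ge0; [exact: corner_cone cP _ Pp k | exact/ltW/interior_slack].
Qed.

(** The dual polytope contains 0 and d linearly independent vectors. *)
Lemma dual_polytope_dim : has_dim D d.
Proof.
apply: (@has_dim_mx _ _ _ 0 _ (\matrix_k dual_vertex k)).
- apply/row_freeP; exists (\matrix_k (- dot (z - x) (row k G) *: row k E))^T.
  apply/matrixP => k l; transitivity (dot (dual_vertex k) (- dot (z - x) (row l G) *: row l E)).
    by rewrite dotE !mxE; apply: eq_bigr => j _; rewrite !mxE.
  rewrite dotZr [dot _ (row _ E)]dotC edge_dual_vertex mulrA mulrNN !mxE eq_sym.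
  by have [->|_] := eqVneq; rewrite ?mulr0 // mulfV ?mul1r // gt_eqF ?interior_slack.
- exact: dual0.
- by move=> k; rewrite add0r rowK; exact: dual_vertex_in.
move=> y /dual_polytopeP[yE _]; rewrite subr0.
set M := \matrix_k _.
have -> : y = \sum_k (- dot (z - x) (row k G) * dot (row k E) y) *: row k M.
  apply/eqP; rewrite -subr_eq0; apply/eqP/span_ortho.
    rewrite submx_diff // summx_sub // => k _.
    by rewrite scalemx_sub // rowK dual_vertex_sub.
  move=> l; rewrite dotBr dot_sumr (bigD1 l) //= big1 ?addr0 => [|k kl]; last first.
    by rewrite dotZr rowK edge_dual_vertex eq_sym (negPf kl) !mulr0.
  rewrite dotZr rowK edge_dual_vertex eqxx mulr1 mulrAC mulrNN mulfV ?mul1r ?subrr //.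
  by rewrite gt_eqF ?interior_slack.
by apply: summx_sub => k _; rewrite scalemx_sub // row_sub.
Qed.

(** The face of the dual polytope whose vertices are the [dual_vertex k] for k in K:
    the part of the face dual to x on which the edges outside K are tight too *)
Definition dual_face K : set 'rV[R]_n :=
  D `&` [set y | dot (x - z) y = 1 /\ forall k, k \notin K -> dot (row k E) y = 0].

(** The points x and x + e_k, k outside K, belong to P and so bound the dual
    polytope; summing these bounds gives a functional that attains its maximum
    where they are all equalities. *)
Lemma dual_face_face K : face D (dual_face K).
Proof.
pose a := (x - z) + \sum_(k | k \notin K) (x + row k E - z).
pose b : R := 1 + \sum_(k | k \notin K) 1.
have aE y : dot a y = dot (x - z) y + \sum_(k | k \notin K) dot (x + row k E - z) y.
  by rewrite (dotDl (x - z)) dot_suml.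
have le0 y : D y -> dot (x - z) y <= 1.
  by move=> /dual_polytopeP[_]; apply; exact: corner_apex cP.
have le y k : D y -> dot (x + row k E - z) y <= 1.
  by move=> /dual_polytopeP[_]; apply; exact: (corner_edge cP k).
exists a, b; split=> [y Dy|]; first by rewrite aE lerD ?le0 // ler_sum // => k _; exact: le.
apply/seteqP; split => y [Dy] /=.
  move=> [y1 yK]; split => //=; rewrite aE y1; congr (_ + _); apply: eq_bigr => k kK.
  by rewrite addrAC (dotDl (x - z)) y1 yK // addr0.
move=> yb; split => //=; have /eqP : 0 = (1 - dot (x - z) y) +
    \sum_(k | k \notin K) (1 - dot (x + row k E - z) y).
  by rewrite sumrB addrACA -opprD -aE yb subrr.
rewrite eq_sym paddr_eq0 ?subr_ge0 ?le0 ?sumr_ge0 // => [|k _]; last by rewrite subr_ge0 le.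
rewrite subr_eq0 eq_sym => /andP[/eqP y1]; rewrite y1; split => // k kK.
move: b0; rewrite psumr_eq0 => [/allP/(_ k)|l _]; last by rewrite subr_ge0 le.
rewrite mem_index_enum kK => /(_ isT); rewrite /= addrAC (dotDl (x - z)) y1 opprD addrA subrr add0r.
by rewrite oppr_eq0 => /eqP.
Qed.

Lemma dual_face_boundary K : boundary_complex D (dual_face K).
Proof.
split; first exact: dual_face_face.
move=> e; have := dual0; rewrite -e => -[_ [/eqP]].
by rewrite dot0r eq_sym oner_eq0.
Qed.

Lemma dual_vertex_face K k : k \in K -> dual_face K (dual_vertex k).
Proof.
move=> kK; split; first exact: dual_vertex_in.
split; first by rewrite dot_dual_vertex subrr dot0l mul0r subr0.
move=> l lK; rewrite edge_dual_vertex; have [lk|_] := eqVneq l k; last by rewrite mulr0.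
by rewrite lk kK in lK.
Qed.

Lemma dual_face1 k : dual_face [set k]%SET = [set dual_vertex k].
Proof.
apply/seteqP; split => y /=; last by move=> ->; apply: dual_vertex_face; rewrite inE.
move=> [/dual_polytopeP[yE _] [y1 y0]]; apply: (dual_uniq (k := k)) => //.
- exact: dual_vertex_sub.
- by rewrite y1 dot_dual_vertex subrr dot0l mul0r subr0.
by move=> l lk; rewrite y0 ?inE // edge_dual_vertex (negPf lk) mulr0.
Qed.

Lemma dual_vertex_vertex k : vertex (boundary_complex D) (dual_vertex k).
Proof. by rewrite /vertex /= -dual_face1; exact: dual_face_boundary. Qed.

Lemma dual_face_dim K k0 : k0 \in K -> has_dim (dual_face K) #|(K :\ k0)%SET|.
Proof.
move=> k0K; pose L := (K :\ k0)%SET.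
pose M : 'M[R]_(#|L|, n) := \matrix_j (dual_vertex (enum_val j) - dual_vertex k0).
have LK k : k \in L -> k \in K /\ k != k0 by rewrite in_setD1 => /andP[].
apply: (@has_dim_mx _ _ _ (dual_vertex k0) _ M).
- apply/row_freeP.
  exists (\matrix_j (- dot (z - x) (row (enum_val j) G) *: row (enum_val j) E))^T.
  apply/matrixP => i j.
  transitivity (dot (dual_vertex (enum_val i) - dual_vertex k0)
      (- dot (z - x) (row (enum_val j) G) *: row (enum_val j) E)).
    by rewrite dotE !mxE; apply: eq_bigr => l _; rewrite !mxE.
  have [_ jk0] := LK _ (enum_valP j).
  rewrite dotZr [dot _ (row _ E)]dotC dotBr !edge_dual_vertex (negPf jk0) mulr0 subr0.
  rewrite mulrA mulrNN !mxE.
  rewrite (inj_eq enum_val_inj) eq_sym.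
  by have [->|_] := eqVneq; rewrite ?mulr0 // mulfV ?mul1r // gt_eqF ?interior_slack.
- exact: dual_vertex_face.
- by move=> j; rewrite rowK subrKC; apply: dual_vertex_face; have [] := LK _ (enum_valP j).
move=> y [/dual_polytopeP[yE _] [y1 y0]].
have -> : y - dual_vertex k0 =
    \sum_j (- dot (z - x) (row (enum_val j) G) * dot (row (enum_val j) E) y) *: row j M.
  have ME (j : 'I_#|L|) : (row j M <= E)%MS.
    by rewrite rowK submx_diff ?dual_vertex_sub.
  apply: (dual_uniq (k := k0)).
  - by rewrite submx_diff ?dual_vertex_sub.
  - by rewrite summx_sub // => j _; rewrite scalemx_sub.
  - rewrite dotBr y1 dot_dual_vertex subrr dot0l mul0r subr0 subrr dot_sumr big1 // => j _.
    by rewrite dotZr rowK dotBr !dot_dual_vertex subrr !dot0l !mul0r subrr mulr0.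
  move=> l lk0; rewrite dotBr edge_dual_vertex (negPf lk0) mulr0 subr0 dot_sumr.
  have eM (j : 'I_#|L|) : dot (row l E) (row j M) =
      - (dot (z - x) (row (enum_val j) G))^-1 * (l == enum_val j)%:R.
    by rewrite rowK dotBr !edge_dual_vertex (negPf lk0) mulr0 subr0.
  have [lL|lL] := boolP (l \in L).
    rewrite (bigD1 (enum_rank_in lL l)) //= big1 ?addr0 => [|j jl].
      rewrite dotZr eM enum_rankK_in // eqxx mulr1 mulrAC mulrNN mulfV ?mul1r //.
      by rewrite gt_eqF ?interior_slack.
    rewrite dotZr eM; have [lj|] := eqVneq l (enum_val j); last by rewrite !mulr0.
    by case/eqP: jl; apply: enum_val_inj; rewrite enum_rankK_in.
  rewrite y0; last by move: lL; rewrite in_setD1 lk0.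
  rewrite big1 // => j _; rewrite dotZr eM; have [lj|] := eqVneq l (enum_val j).
    by have := enum_valP j; rewrite -lj (negPf lL).
  by rewrite !mulr0.
by apply: summx_sub => j _; rewrite scalemx_sub // row_sub.
Qed.

End AtCorner.
End DualCorner.

(** Moving by a small multiple e of q violates none of finitely many constraints, if
    q does not affect those that are tight. *)
Lemma perturbation_bound (R : realFieldType) (I : finType) (p q : I -> R) :
  (forall i, p i <= 1) -> (forall i, p i = 1 -> q i = 0) ->
  exists2 e : R, 0 < e & forall i, p i + e * `|q i| <= 1.
Proof.
move=> p1 pq; pose S := \sum_i `|q i| / (1 - p i).
have pos i : 0 <= `|q i| / (1 - p i) by rewrite divr_ge0 // subr_ge0.
have S0 : 0 < 1 + S by rewrite ltr_pwDl // sumr_ge0.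
exists (1 + S)^-1 => [|i]; first by rewrite invr_gt0.
have [e|ne] := eqVneq (p i) 1; first by rewrite e pq // normr0 mulr0 addr0.
have pi_lt : 0 < 1 - p i by rewrite subr_gt0 lt_neqAle ne p1.
rewrite addrC -lerBrDr ler_pdivrMl // mulrC -ler_pdivrMl // mulrC.
by rewrite /S (bigD1 i) //= addrCA lerDl addr_ge0 // sumr_ge0.
Qed.

Section DualBoundary.
Context {R : realType} {n m d : nat} (v : 'I_m -> 'rV[R]_n) (z : 'rV[R]_n).
Implicit Types (x y a c : 'rV[R]_n) (F : set 'rV[R]_n) (i j : 'I_m).
Let P := convex_hull v.
Let D := dual_polytope P z.
Context (zP : relative_interior P z).

Section AtCorner.
Context (x : 'rV[R]_n) (E G : 'M[R]_(d, n)) (cP : corner P x E G).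

(** Such a functional is given by a point of P, up to scaling: if that point were
    outside P, a hyperplane separating it from P would yield a point of the dual
    polytope at which a exceeds b. *)
Lemma dual_bipolar a (b : R) : 0 < b -> (forall y, D y -> dot a y <= b) ->
  exists2 p, P p & forall y, D y -> dot a y = b * dot (p - z) y.
Proof.
move=> b_gt0 Dab; have [a' a'E aa'] := span_project cP a.
exists (z + b^-1 *: a'); last first.
  move=> y /(dual_polytopeP zP cP)[yE _].
  by rewrite addrC addKr dotZl mulrA mulfV ?gt_eqF // mul1r aa'.
apply: contrapT => /separation[c [t [ct tc]]]; have [c' c'E cc'] := span_project cP c.
have s_gt0 : 0 < t - dot c z by rewrite subr_gt0 ct //; exact: relative_interior_mem zP.
set s := t - dot c z in s_gt0; pose y := s^-1 *: c'.
have yE : (y <= E)%MS by rewrite scalemx_sub.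
have Dy : D y.
  apply/(dual_polytopeP zP cP); split => // p Pp.
  rewrite dotZr dotC -cc' ?(corner_diff cP) //; last exact: relative_interior_mem zP.
  by rewrite ler_pdivrMl // mulr1 dotBr lerB // ltW // ct.
have := Dab y Dy; rewrite aa' // dotZr ler_pdivrMl // leNgt => /negP; apply.
move: tc; rewrite dotDr addrC -ltrBlDr -/s dotZr cc' // (dotC c').
by rewrite ltr_pdivlMl // mulrC.
Qed.

Lemma dual_small y : (y <= E)%MS -> exists2 e : R, 0 < e & D (e *: y).
Proof.
move=> yE; pose M := 1 + \sum_i `|dot (v i - z) y|.
have M_gt0 : 0 < M by rewrite ltr_pwDl // sumr_ge0.
exists M^-1; first by rewrite invr_gt0.
apply: (dual_polytope_hull zP cP); first by rewrite scalemx_sub.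
move=> i; rewrite dotZr ler_pdivrMl // mulr1 (le_trans (ler_norm _)) //.
by rewrite /M (bigD1 i) //= addrCA lerDl addr_ge0 // sumr_ge0.
Qed.

(** A functional supporting a proper face is positive on it, as the dual polytope
    is a neighborhood of 0 in the span of E; so the bipolar argument applies to it. *)
Lemma dual_boundary_point F : boundary_complex D F -> F !=set0 ->
  exists2 p, P p & forall y, F y -> dot (p - z) y = 1.
Proof.
move=> [[a [b [Dab FE]]] FD] _.
have b_ge0 : 0 <= b by rewrite -(dot0r a); apply: Dab; exact: (dual0 zP cP).
move: b_ge0; rewrite le_eqVlt => /predU1P[b0|b_gt0].
  case: FD; rewrite FE; apply/setIidPl => y Dy /=; rewrite -b0.
  have neg u : (u <= E)%MS -> dot a u <= 0.
    move=> /dual_small[e e_gt0 /Dab]; rewrite -b0 dotZr pmulr_rle0 //.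
  have /(dual_polytopeP zP cP)[yE _] := Dy.
  apply/eqP; rewrite eq_le neg //= -oppr_le0 -dotNr neg //.
  by rewrite eqmx_opp.
have [p Pp pE] := dual_bipolar b_gt0 Dab; exists p => // y; rewrite FE => -[Dy /= yb].
by apply: (mulfI (lt0r_neq0 b_gt0)); rewrite -pE // mulr1.
Qed.

End AtCorner.

(** The face of P in which the hyperplane dual to y supports P *)
Definition dual_facet y : set 'rV[R]_n := P `&` [set p | dot (p - z) y = 1].

Lemma dual_facet_face y : D y -> face P (dual_facet y).
Proof.
move=> [_ Dy]; exists y, (1 + dot y z); split=> [p /Dy|].
  by rewrite dotBl lerBlDr !(dotC _ y).
by apply/seteqP; split => p [Pp /= e]; split => //=; move: e; rewrite dotBl !(dotC _ y);
  [move/(canRL (subrK _)) | move=> ->; rewrite addrK].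
Qed.

Context (vP : strictly_exposed v) (simP : simple_polytope P) (dimP : has_dim P d).
Context (d_gt0 : (0 < d)%N).

(** The hyperplane dual to a vertex y supports P in a face that contains a vertex of
    P by [dual_boundary_point].  Were this face smaller than a facet, y could be
    moved both ways inside the dual polytope, and would not be exposed. *)
Lemma vertex_dual_facet y : vertex (boundary_complex D) y ->
  exists i (E G : 'M[R]_(d, n)) k,
    corner P (v i) E G /\ dual_facet y = corner_face P (v i) G (~: [set k])%SET.
Proof.
move=> yD; have [[a [b [Dab yE]]] _] := yD.
have [Dy yb] : D y /\ dot a y = b.
  by have : (D `&` [set y | dot a y = b]) y by rewrite -yE.
have [i0 [E0 [G0 cP0]]] := some_corner vP simP dimP.
have [|p Pp py] := dual_boundary_point cP0 yD; first by exists y.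
have fy := dual_facet_face Dy.
have [|i Fi] := face_has_vertex fy (_ : dual_facet y p); first by split => //; exact: py.
have [E [G cP]] := corner_at vP simP dimP i; exists i, E, G.
have [K FK] := face_corner_face cP fy Fi.
suff /cards1P[k Kk] : #|~: K|%SET == 1%N by exists k; split => //; rewrite FK -Kk finset.setCK.
have yv j : dot (v j - z) y <= 1 by have [_] := Dy; apply; exact: hull_gen.
have inK j k : dot (v j - z) y = 1 -> k \notin K -> dot (v j - v i) (row k G) = 0.
  move=> jy kK; have : dual_facet y (v j) by split => //; exact: hull_gen.
  by rewrite FK => -[_]; apply.
have [/eqP|[k kK]] := set_0Vmem (~: K)%SET.
  rewrite -finset.setCT (inj_eq (can_inj (@finset.setCK _))) => /eqP KT.
  have : dual_facet y z.
    by rewrite FK KT; split => [|k]; [exact: relative_interior_mem zP | rewrite inE].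
  by move=> [_ /= /eqP]; rewrite subrr dot0l eq_sym oner_eq0.
apply/cards1P; exists k; apply/eqP; rewrite finset.eqEsubset finset.sub1set kK andbT.
apply/fintype.subsetP => l lK; rewrite inE; apply: contraT => lk.
rewrite inE in kK; rewrite inE in lK.
have mu := interior_slack zP cP.
(* The constraints tight at y stay tight along u, which is normal to the edges in K
   and to z - v i. *)
pose u := dot (z - v i) (row l G) *: row k G - dot (z - v i) (row k G) *: row l G.
have uE : (u <= E)%MS.
  by apply: submx_diff; rewrite scalemx_sub // (submx_trans (row_sub _ _) (corner_sub cP)).
have u0 j : dot (v j - z) y = 1 -> dot (v j - z) u = 0.
  move=> jy; have -> : v j - z = (v j - v i) - (z - v i) by rewrite opprB addrA subrK.
  rewrite (dotBl (v j - v i)) !(dotBr (_ *: _)) !dotZr !(inK j) // !mulr0 subrr sub0r.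
  by rewrite mulrC subrr oppr0.
have [e e_gt0 eP] := perturbation_bound yv u0.
have Dpm (s : R) : `|s| <= e -> D (y + s *: u).
  have [yE' _] := (dual_polytopeP zP cP y).1 Dy.
  move=> se; apply: (dual_polytope_hull zP cP); first by rewrite addmx_sub // scalemx_sub.
  move=> j; rewrite dotDr dotZr; apply: le_trans (eP j); rewrite lerD2l.
  by rewrite (le_trans (ler_norm _)) // normrM ler_wpM2r.
have au : dot a u = 0.
  have ee : `|e| <= e by rewrite gtr0_norm.
  have ene : `|- e| <= e by rewrite normrN.
  have := Dab _ (Dpm (- e) ene); have := Dab _ (Dpm e ee); 
  rewrite (dotDr y (e *: u)) (dotDr y (- e *: u)) !(dotZr _ u) yb mulNr !gerDl oppr_le0 => h1 h2.
  apply: (mulfI (lt0r_neq0 e_gt0)); rewrite mulr0.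
  by apply/eqP; rewrite eq_le h1 h2.
have : [set y] (y + e *: u).
  rewrite yE; split; first by apply: Dpm; rewrite gtr0_norm.
  by rewrite /= (dotDr y) (dotZr _ u) au mulr0 addr0.
move=> /= /eqP; rewrite -subr_eq0 addrC addKr scaler_eq0 gt_eqF //= => /eqP u00.
have := congr1 (dot (row k E)) u00; rewrite dot0r dotBr !dotZr !(corner_dot cP) eqxx.
by rewrite eq_sym (negPf lk) mulr0 subr0 mulr1 => /eqP; rewrite gt_eqF // mu.
Qed.

Lemma dual_facet_facet y : vertex (boundary_complex D) y -> facet P (dual_facet y).
Proof.
move=> /vertex_dual_facet[i [E [G [k [cP ->]]]]].
exact: (facet_corner_face dimP d_gt0 cP k).
Qed.

Lemma vertex_in_dual y : vertex (boundary_complex D) y -> D y.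
Proof. by move=> [/face_sub + _]; apply. Qed.

(** A facet contains a vertex and all edges at it but one, so [dual_uniq] applies. *)
Lemma dual_facet_inj y y' : vertex (boundary_complex D) y ->
  vertex (boundary_complex D) y' -> dual_facet y = dual_facet y' -> y = y'.
Proof.
move=> /[dup] yD /vertex_dual_facet[i [E [G [k [cP yF]]]]] y'D e.
have [yE _] := (dual_polytopeP zP cP y).1 (vertex_in_dual yD).
have [y'E _] := (dual_polytopeP zP cP y').1 (vertex_in_dual y'D).
have at_i w : dual_facet w = corner_face P (v i) G (~: [set k])%SET -> dot (v i - z) w = 1.
  by move=> wF; have := corner_face_apex cP (~: [set k])%SET; rewrite -wF => -[].
have at_e w l : dual_facet w = corner_face P (v i) G (~: [set k])%SET -> l != k ->
    dot (row l E) w = 0.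
  move=> wF lk; have : dual_facet w (v i + row l E).
    by rewrite wF; apply/(corner_face_edge cP); rewrite !inE.
  move=> [_ /=]; rewrite addrAC (dotDl (v i - z)) at_i // => /eqP.
  by rewrite -subr_eq0 addrC addKr => /eqP.
have y'F := etrans (esym e) yF.
apply: (dual_uniq zP cP (k := k)) => //; first by rewrite !at_i.
by move=> l lk; rewrite !at_e.
Qed.

Lemma dual_facet_vertex i (E G : 'M[R]_(d, n)) (cP : corner P (v i) E G) k :
  dual_facet (dual_vertex z (v i) G k) = corner_face P (v i) G (~: [set k])%SET.
Proof.
have mu := interior_slack zP cP.
apply/seteqP; split => p [Pp /= pk]; split => //.
  move=> l; rewrite !inE negbK => /eqP ->; move: pk; rewrite (dot_dual_vertex zP cP) => /eqP.
  by rewrite subr_eq addrC -subr_eq subrr eq_sym mulf_eq0 invr_eq0 (gt_eqF (mu k)) orbF => /eqP.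
by rewrite /= (dot_dual_vertex zP cP) pk ?mul0r ?subr0 // !inE negbK.
Qed.

Lemma facet_dual_vertex F : facet P F ->
  exists2 y, vertex (boundary_complex D) y & dual_facet y = F.
Proof.
move=> fF; have [_ [_ [_ /has_dim_nonempty[x Fx]]]] := fF.
have [i Fi] := face_has_vertex fF.1 Fx; have [E [G cP]] := corner_at vP simP dimP i.
have [k Fk] := facet_at_corner dimP cP fF Fi.
exists (dual_vertex z (v i) G k); first exact: (dual_vertex_vertex zP cP k).
by rewrite Fk (dual_facet_vertex cP).
Qed.

(** A point p of P dual to the edge lies on both facets.  Conversely, two distinct
    facets that meet are opposite to two edges k and l at a common vertex, and the
    dual face with K = {k, l} is an edge. *)
Lemma joined_dual_facets y y' : vertex (boundary_complex D) y ->
  vertex (boundary_complex D) y' ->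
  joined_by_edge (boundary_complex D) y y' <->
  dual_facet y <> dual_facet y' /\ dual_facet y `&` dual_facet y' !=set0.
Proof.
move=> yD y'D; split.
  move=> [yy' [e [eD de ey ey']]]; split; first by move/dual_facet_inj => /(_ yD y'D).
  have [i0 [E0 [G0 cP0]]] := some_corner vP simP dimP.
  have [|p Pp pe] := dual_boundary_point cP0 eD; first by exists y.
  by exists p; split; split => //; exact: pe.
move=> [nF]; have fy := dual_facet_facet yD; have fy' := dual_facet_facet y'D.
move=> /(meeting_faces fy.1 fy'.1)[i [Fi F'i]].
have [E [G cP]] := corner_at vP simP dimP i.
have at_i w : vertex (boundary_complex D) w -> dual_facet w (v i) ->
    exists k, w = dual_vertex z (v i) G k.
  move=> wD wi; have [k wk] := facet_at_corner dimP cP (dual_facet_facet wD) wi.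
  exists k; apply: dual_facet_inj => //; first exact: (dual_vertex_vertex zP cP k).
  by rewrite wk (dual_facet_vertex cP).
have [k yk] := at_i y yD Fi; have [l y'l] := at_i y' y'D F'i.
have kl : k != l by apply: contra_not_neq nF => kl; rewrite yk y'l kl.
split; first by move=> yy'; apply: nF; rewrite yy'.
exists (dual_face v z (v i) E [set k; l]%SET); split.
- exact: (dual_face_boundary zP cP _).
- have := dual_face_dim zP cP (set21 k l).
  by rewrite finset.setU1K ?cards1 // inE.
- by rewrite yk; exact: (dual_vertex_face zP cP (set21 k l)).
- by rewrite y'l; exact: (dual_vertex_face zP cP (set22 k l)).
Qed.

(** Otherwise the face would have the same affine hull as the dual polytope, which
    contains 0, contrary to [dual_boundary_point]. *)
Lemma dual_boundary_dim F k : boundary_complex D F -> has_dim F k -> (k < d)%N.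
Proof.
move=> FD Fk; have [i0 [E0 [G0 cP0]]] := some_corner vP simP dimP.
have [p Pp pF] := dual_boundary_point cP0 FD (has_dim_nonempty Fk).
have [kd aff] := has_dim_sub Fk (dual_polytope_dim zP cP0) (face_sub FD.1).
rewrite ltn_neqAle kd andbT; apply/eqP => /aff e.
have : affine_hull F 0 by rewrite e; apply: affine_hull_gen; exact: (dual0 zP cP0).
by move/(affine_hull_dot pF)/eqP; rewrite dot0r eq_sym oner_eq0.
Qed.

Lemma dual_complex_dim : complex_dim (boundary_complex D) d.-1.
Proof.
split; last first.
  by move=> F k FD Fk; rewrite -ltnS prednK //; exact: (dual_boundary_dim FD Fk).
have [i0 [E0 [G0 cP0]]] := some_corner vP simP dimP.
exists (dual_face v z (v i0) E0 [set: 'I_d]%SET).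
split; first exact: (dual_face_boundary zP cP0 _).
have := dual_face_dim zP cP0 (finset.in_setT (Ordinal d_gt0)).
by rewrite finset.setTD cardsC1 card_ord.
Qed.

Lemma balanced_dualP : balanced (boundary_complex D) <->
  colorable (facet P) (fun F F' => F <> F' /\ F `&` F' !=set0) d.
Proof.
split.
  move=> [k [[[F [FD Fk]] _] [c cP]]].
  have kd := dual_boundary_dim FD Fk.
  pose g F' := xget 0 [set y | vertex (boundary_complex D) y /\ dual_facet y = F'].
  have gP F' : facet P F' -> vertex (boundary_complex D) (g F') /\ dual_facet (g F') = F'.
    by move=> /facet_dual_vertex[y yD yF]; rewrite /g; case: xgetP => [w _ //|/(_ y)[]].
  exists (fun F' => c (g F') : nat); split=> [F' _|F1 F2 fF1 fF2 FF].
    by apply: leq_trans kd; exact: ltn_ord.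
  have [g1 e1] := gP F1 fF1; have [g2 e2] := gP F2 fF2.
  move/val_inj; apply: cP => //; apply/(joined_dual_facets g1 g2); rewrite e1 e2.
  exact: FF.
move=> [c [c_lt cP]]; exists d.-1; split; first exact: dual_complex_dim.
exists (fun y => inord (c (dual_facet y))) => y y' yD y'D /(joined_dual_facets yD y'D) yy'.
have fy := dual_facet_facet yD; have fy' := dual_facet_facet y'D.
move/(congr1 val); rewrite /= !inordK ?(prednK d_gt0) ?c_lt //.
exact: cP.
Qed.

End DualBoundary.

Theorem theorem4p5 (R : realType) (n d : nat) (P : set 'rV[R]_n)
    (z : 'rV[R]_n) (d_ge1 : (1 <= d)%N) (simpleP : simple_polytope P)
    (dimP : has_dim P d) (zP : relative_interior P z) :
  [<-> even_polytope P;
       bipartite (vertex (face P)) (joined_by_edge (face P));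
       balanced (boundary_complex (dual_polytope P z));
       gamma P = d].
Proof.
have [polyP _] := simpleP; have [m [v [PE vP]]] := polytope_vertices polyP.
subst P.
have inc := facet_incidence vP simpleP dimP d_ge1.
have evenP := even_polytopeP vP simpleP dimP d_ge1.
have bipP := bipartite_polytopeP vP simpleP dimP d_ge1.
have gamP := gammaP vP simpleP dimP d_ge1.
have balP := balanced_dualP zP vP simpleP dimP d_ge1.
have colP := @colorable_facetsP R n m v d.
have [a a_inj] := generic_functional (strictly_exposed_inj vP).
have lmin := linear_local_min vP simpleP dimP d_ge1 (a := a).
have lmax : local_min_global (facet_family v) (fun i => - dot a (v i))%R.
  have := linear_local_min vP simpleP dimP d_ge1 (a := - a)%R.
  by congr local_min_global; apply/funext => i; rewrite dotNl.
tfae.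
- by move/evenP => ev; apply/bipP; exact: (even_bipartite inc a_inj lmax ev).
- move=> /bipP[col /(bipartite_even inc) ev].
  apply/balP/colP; exact: (even_colored inc a_inj lmin lmax ev).
- by move=> /balP/colP/gamP.
- by move=> /gamP[c /(colored_even inc)/evenP].
Qed.
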